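(* Let $\mathfrak{g}$ be a pre-Lie algebra with sub-adjacent Lie algebra $\mathfrak{g}^c$, and let $V$ be a $\mathfrak{g}$-module (a representation of $\mathfrak{g}$). Regard $\mathrm{Hom}(\mathfrak{g},V)$ as a $\mathfrak{g}^c$-module via $$(x\triangleright f)(y):=x\circ_l f(y)+f(x)\circ_r y-f(x\circ y),\qquad f\in\mathrm{Hom}(\mathfrak{g},V),\ x,y\in\mathfrak{g}.$$ Then there is a one-to-one correspondence between the set $\mathrm{CExt}(\mathfrak{g},V)$ of equivalence classes of crossed module extensions of $\mathfrak{g}$ by $V$ inducing the given representation of $\mathfrak{g}$ on $V$, and the set $\mathrm{AExt}(\mathfrak{g}^c,\mathrm{Hom}(\mathfrak{g},V))$ of equivalence classes of abelian extensions of the Lie algebra $\mathfrak{g}^c$ by the $\mathfrak{g}^c$-module $\mathrm{Hom}(\mathfrak{g},V)$.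
   Context: All vector spaces are over a fixed ground field; $\mathrm{Hom}(\mathfrak{g},V)$ denotes linear maps. **Pre-Lie algebra.** A pre-Lie algebra $(\mathfrak{g},\circ)$ is a vector space $\mathfrak{g}$ with a bilinear map $\circ:\mathfrak{g}\otimes\mathfrak{g}\to\mathfrak{g}$ such that $(x\circ y)\circ z-x\circ(y\circ z)=(y\circ x)\circ z-y\circ(x\circ z)$ for all $x,y,z\in\mathfrak{g}$. The bracket $[x,y]:=x\circ y-y\circ x$ is a Lie bracket on $\mathfrak{g}$; the resulting Lie algebra is the sub-adjacent Lie algebra $\mathfrak{g}^c$. Homomorphisms of pre-Lie algebras are linear maps preserving $\circ$; $\mathbf{preLie}$ is the resulting category. **Representation.** A representation of $(\mathfrak{g},\circ)$ (also called a $\mathfrak{g}$-module) is a triple $(V,\circ_l,\circ_r)$ where $V$ is a vector space, $\circ_l:\mathfrak{g}\otimes V\to V$ is a representation of the Lie algebra $\mathfrak{g}^c$ on $V$ (i.e. $[x,y]\circ_l u=x\circ_l(y\circ_l u)-y\circ_l(x\circ_l u)$), and $\circ_r:V\otimes\mathfrak{g}\to V$ is bilinear with $(x\circ_l u)\circ_r y-x\circ_l(u\circ_r y)=(u\circ_r x)\circ_r y-u\circ_r(x\circ y)$ for all $x,y\in\mathfrak{g}$, $u\in V$. **Action.** For pre-Lie algebras $(\mathfrak{m},\circ_m)$, $(\mathfrak{n},\circ_n)$, an action of $\mathfrak{n}$ on $\mathfrak{m}$ is a representation $(\circ_l,\circ_r)$ of $\mathfrak{n}$ on the vector space $\mathfrak{m}$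 such that for all $x\in\mathfrak{n}$, $u,v\in\mathfrak{m}$: $(x\circ_l u)\circ_m v-x\circ_l(u\circ_m v)=(u\circ_r x)\circ_m v-u\circ_m(x\circ_l v)$ and $(u\circ_m v)\circ_r x-u\circ_m(v\circ_r x)=(v\circ_m u)\circ_r x-v\circ_m(u\circ_r x)$. **Crossed module.** Given an action $(\circ_l,\circ_r)$ of $\mathfrak{n}$ on $\mathfrak{m}$, a crossed module $(\mathfrak{m}\xrightarrow{\mu}\mathfrak{n},\circ_l,\circ_r)$ is a homomorphism $\mu:\mathfrak{m}\to\mathfrak{n}$ of pre-Lie algebras such that for all $x\in\mathfrak{n}$, $u,v\in\mathfrak{m}$: $\mu(u\circ_r x)=\mu(u)\circ_n x$, $\mu(x\circ_l u)=x\circ_n\mu(u)$, and $\mu(u)\circ_l v=u\circ_m v=u\circ_r\mu(v)$. **Crossed module extension.** Let $V$ be a representation of $\mathfrak{g}$, regarded as a pre-Lie algebra with zero product. A crossed module extension of $\mathfrak{g}$ by $V$ is an exact sequence in $\mathbf{preLie}$ $$0\to V\xrightarrow{i}\mathfrak{m}\xrightarrow{\mu}\mathfrak{n}\xrightarrow{\pi}\mathfrak{g}\to0$$ together with an action of $\mathfrak{n}$ on $\mathfrak{m}$ making $\mathfrak{m}\xrightarrow{\mu}\mathfrak{n}$ a crossed module. Such an extension induces a representation of $\mathfrak{g}$ on $V$: for any linear section $\rho:\mathfrak{g}\to\mathfrak{n}$ of $\pi$ (so $\pi\rho=\mathrm{id}$), put $i(x\circ_l u):=\rho(x)\circ_l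 i(u)$ and $i(u\circ_r x):=i(u)\circ_r\rho(x)$ for $x\in\mathfrak{g}$, $u\in V$; this does not depend on $\rho$. **Equivalence.** Two crossed module extensions $E:0\to V\xrightarrow{i}\mathfrak{m}\xrightarrow{\mu}\mathfrak{n}\xrightarrow{\pi}\mathfrak{g}\to0$ and $E':0\to V\xrightarrow{i'}\mathfrak{m}'\xrightarrow{\mu'}\mathfrak{n}'\xrightarrow{\pi'}\mathfrak{g}\to0$ are elementary equivalent, written $E\hookrightarrow E'$, if there are pre-Lie homomorphisms $r:\mathfrak{m}\to\mathfrak{m}'$ and $s:\mathfrak{n}\to\mathfrak{n}'$ with $r i=i'$, $s\mu=\mu' r$, $\pi' s=\pi$, and $r(u\circ_r x)=r(u)\circ_r s(x)$, $r(x\circ_l u)=s(x)\circ_l r(u)$ for all $x\in\mathfrak{n}$, $u\in\mathfrak{m}$. Equivalence $\sim$ is the equivalence relation generated by $\hookrightarrow$ (i.e. extensions connected by a finite zigzag of elementary equivalences). $\mathrm{CExt}(\mathfrak{g},V)$ is the set of $\sim$-classes of crossed module extensions of $\mathfrak{g}$ by $V$ which induce the given representation of $\mathfrak{g}$ on $V$. **Abelian extensions of Lie algebras.** Let $A$ be a Lie algebra and $W$ an $A$-module, regarded as an abelian Lie algebra. An abelian extension of $A$ by $W$ is an exact sequence of Lie algebras $0\to W\to\hat A\to A\to0$ for which the induced action of $A$ on $W$ (lift an element of $A$ to $\hat A$ and bracket with $W$) is the given module structure. Two abelian extensions $\hat A_1,\hat A_2$ of $A$ by $W$ are equivalent if there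 is a Lie algebra homomorphism $\gamma:\hat A_2\to\hat A_1$ commuting with the maps from $W$ and the maps to $A$ (inducing the identity on $W$ and on $A$). $\mathrm{AExt}(A,W)$ is the set of equivalence classes. *)

(* Defs.v *)
From HB Require Import structures.
From mathcomp Require Import all_boot all_algebra.
From mathcomp Require Import boolp.
From Stdlib Require Import Relation_Operators.

Set Implicit Arguments.
Unset Strict Implicit.
Unset Printing Implicit Defensive.

Import GRing.Theory.
Local Open Scope ring_scope.

Reserved Notation "x <o> y" (at level 40, left associativity).
Reserved Notation "[| x , y |]" (at level 0, x, y at level 99).

Section LinearMaps.
Variables (K : fieldType) (U V : lmodType K).
Implicit Types f g h : {linear U -> V}.

Lemma linearP_ext f g : f =1 g -> f = g.
Proof.
case: f g => [f [[f1] [f2]]] [g [[g1] [g2]]] /= /funext fg.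
by subst g; rewrite (Prop_irrelevance f1 g1) (Prop_irrelevance f2 g2).
Qed.

HB.instance Definition _ := gen_eqMixin {linear U -> V}.
HB.instance Definition _ := gen_choiceMixin {linear U -> V}.

Definition lin_zero : {linear U -> V} := \0.
Definition lin_add f g : {linear U -> V} := f \+ g.
Definition lin_opp f : {linear U -> V} := \- f.
Definition lin_scale (a : K) f : {linear U -> V} := a \*: f.

Lemma lin_addA : associative lin_add.
Proof. by move=> f g h; apply: linearP_ext => x /=; rewrite addrA. Qed.
Lemma lin_addC : commutative lin_add.
Proof. by move=> f g; apply: linearP_ext => x /=; rewrite addrC. Qed.
Lemma lin_add0 : left_id lin_zero lin_add.
Proof. by move=> f; apply: linearP_ext => x /=; rewrite add0r. Qed.
Lemma lin_addN : left_inverse lin_zero lin_opp lin_add.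
Proof. by move=> f; apply: linearP_ext => x /=; rewrite addNr. Qed.

HB.instance Definition _ :=
  GRing.isZmodule.Build {linear U -> V} lin_addA lin_addC lin_add0 lin_addN.

Lemma lin_scaleA a b f : lin_scale a (lin_scale b f) = lin_scale (a * b) f.
Proof. by apply: linearP_ext => x /=; rewrite scalerA. Qed.
Lemma lin_scale1 : left_id 1 lin_scale.
Proof. by move=> f; apply: linearP_ext => x /=; rewrite scale1r. Qed.
Lemma lin_scaleDr : right_distributive lin_scale +%R.
Proof. by move=> a f g; apply: linearP_ext => x /=; rewrite scalerDr. Qed.
Lemma lin_scaleDl f : {morph lin_scale^~ f : a b / a + b}.
Proof. by move=> a b; apply: linearP_ext => x /=; rewrite scalerDl. Qed.

HB.instance Definition _ :=
  GRing.Zmodule_isLmodule.Build K {linear U -> V}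
    lin_scaleA lin_scale1 lin_scaleDr lin_scaleDl.

Lemma lin_addE f g x : (f + g) x = f x + g x. Proof. by []. Qed.
Lemma lin_oppE f x : (- f) x = - f x. Proof. by []. Qed.
Lemma lin_scaleE a f x : (a *: f) x = a *: f x. Proof. by []. Qed.

End LinearMaps.

Section TrivialProduct.
Variables (K : fieldType) (U V W : lmodType K).

Definition zero_prod (u : U) (v : V) : W := 0.

Lemma zero_prod_bilinear : bilinear_for *:%R *:%R zero_prod.
Proof. by split=> u a x y; rewrite /zero_prod addr0 /= scaler0. Qed.

HB.instance Definition _ :=
  bilinear_isBilinear.Build K U V W *:%R *:%R zero_prod zero_prod_bilinear.

End TrivialProduct.

Lemma zmod_swap (V : zmodType) (a b c d : V) : a - b = c - d -> a - c = b - d.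
Proof.
move=> abcd; rewrite -[a](subrK b) abcd.
by rewrite [LHS](ACl ((1*4)*(3*2))) /= subrr add0r.
Qed.

Lemma zmod_jacobi (V : zmodType) (a b c d e f : V) :
  (a - b - (c - d)) + (c - e - (f - b)) + (f - d - (a - e)) = 0.
Proof.
rewrite !opprB !addrA.
rewrite [LHS](ACl ((1*12)*(7*2)*(3*10)*(5*4)*(11*6)*(9*8))) /=.
by rewrite !subrr !addr0.
Qed.
Lemma zmod_hom (V : zmodType) (A A' B B' C D D' E E' F F' G H H' : V) :
  (A - A') + (F' - F) - (H' - H) =
  ((A + B - C) + (D + (D' - B + E) - F) - (G + E - H)) -
  ((A' + B' - G) + (D' + (D - B' + E') - F') - (C + E' - H')).
Proof.
have red (a b c d d' e f k h : V) :
    (a + b - c) + (d + (d' - b + e) - f) - (k + e - h) =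
    (a + h - f) + (d' + d) - (c + k).
  rewrite opprB [k + e]addrC !opprD !addrA.
  rewrite [LHS](ACl ((1*9*8*5*4*3*11)*(2*6)*(7*10))) /=.
  by rewrite !subrr !addr0.
rewrite !red !opprD !opprK !addrA.
rewrite [RHS](ACl (1*8*10*3*9*2*(4*12)*(5*11)*(14*6)*(13*7))) /=.
by rewrite !subrr !addr0.
Qed.

Record lieAlg (K : fieldType) := LieAlg {
  lie_space :> lmodType K;
  lie_br : {bilinear lie_space -> lie_space -> lie_space};
  lie_alt : forall x, lie_br x x = 0;
  lie_jacobi : forall x y z,
    lie_br x (lie_br y z) + lie_br y (lie_br z x) + lie_br z (lie_br x y) = 0 }.

Notation "[| x , y |]" := (lie_br _ x y) : ring_scope.

Record lieHom (K : fieldType) (A B : lieAlg K) := LieHom {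
  lie_fun :> {linear A -> B};
  lie_funM : forall x y : A, lie_fun [| x, y |] = [| lie_fun x, lie_fun y |] }.

Record lieRep (K : fieldType) (A : lieAlg K) (W : lmodType K) := LieRep {
  lie_act :> {bilinear A -> W -> W};
  lie_actP : forall (x y : A) (w : W),
    lie_act [| x, y |] w = lie_act x (lie_act y w) - lie_act y (lie_act x w) }.

Section AbelianLie.
Variables (K : fieldType) (W : lmodType K).
Let br : {bilinear W -> W -> W} := @zero_prod K W W W.

Lemma abelian_alt x : br x x = 0. Proof. by []. Qed.
Lemma abelian_jacobi x y z : br x (br y z) + br y (br z x) + br z (br x y) = 0.
Proof. by rewrite /br /= /zero_prod !addr0. Qed.

Definition abelianLie : lieAlg K := LieAlg abelian_alt abelian_jacobi.
End AbelianLie.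

Record preLieAlg (K : fieldType) := PreLieAlg {
  pl_space :> lmodType K;
  pl_mul : {bilinear pl_space -> pl_space -> pl_space};
  pl_mulP : forall x y z,
    pl_mul (pl_mul x y) z - pl_mul x (pl_mul y z) =
    pl_mul (pl_mul y x) z - pl_mul y (pl_mul x z) }.

Notation "x <o> y" := (pl_mul _ x y) : ring_scope.

Record plHom (K : fieldType) (g h : preLieAlg K) := PLHom {
  pl_fun :> {linear g -> h};
  pl_funM : forall x y : g, pl_fun (x <o> y) = pl_fun x <o> pl_fun y }.

Section TrivialPreLie.
Variables (K : fieldType) (V : lmodType K).
Let mul : {bilinear V -> V -> V} := @zero_prod K V V V.

Lemma trivial_mulP x y z :
  mul (mul x y) z - mul x (mul y z) = mul (mul y x) z - mul y (mul x z).
Proof. by []. Qed.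

Definition trivialPL : preLieAlg K := PreLieAlg trivial_mulP.
End TrivialPreLie.

Section SubAdjacent.
Variables (K : fieldType) (g : preLieAlg K).

Definition pl_br (x y : g) : g := x <o> y - y <o> x.

Lemma pl_br_bilinear : bilinear_for *:%R *:%R pl_br.
Proof.
by split=> u a x y; rewrite /pl_br linearPl linearPr /= scalerBr opprD addrACA.
Qed.

HB.instance Definition _ :=
  bilinear_isBilinear.Build K g g g *:%R *:%R pl_br pl_br_bilinear.

Lemma pl_br_alt x : pl_br x x = 0.
Proof. by rewrite /pl_br subrr. Qed.

Lemma pl_br_jacobi x y z :
  pl_br x (pl_br y z) + pl_br y (pl_br z x) + pl_br z (pl_br x y) = 0.
Proof.
have brE (a b c : g) :
    (a <o> b - b <o> a) <o> c = a <o> (b <o> c) - b <o> (a <o> c).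
  by rewrite linearBl; apply/zmod_swap/pl_mulP.
by rewrite /pl_br !brE !linearBr; apply: zmod_jacobi.
Qed.

Definition subadjacent : lieAlg K :=
  @LieAlg K g (pl_br : {bilinear g -> g -> g}) pl_br_alt pl_br_jacobi.

End SubAdjacent.

Record plRep (K : fieldType) (g : preLieAlg K) (V : lmodType K) := PLRep {
  actl : {bilinear g -> V -> V};
  actr : {bilinear V -> g -> V};
  actlP : forall (x y : g) (u : V),
    actl (pl_br x y) u = actl x (actl y u) - actl y (actl x u);
  actrP : forall (x y : g) (u : V),
    actr (actl x u) y - actl x (actr u y) = actr (actr u x) y - actr u (x <o> y) }.

Record plAction (K : fieldType) (n m : preLieAlg K) := PLAction {
  action_rep :> plRep n m;
  actionlP : forall (x : n) (u v : m),
    actl action_rep x u <o> v - actl action_rep x (u <o> v) =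
    actr action_rep u x <o> v - u <o> actl action_rep x v;
  actionrP : forall (x : n) (u v : m),
    actr action_rep (u <o> v) x - u <o> actr action_rep v x =
    actr action_rep (v <o> u) x - v <o> actr action_rep u x }.

Record crossedModule (K : fieldType) (m n : preLieAlg K) := CrossedModule {
  cm_action :> plAction n m;
  cm_mu : plHom m n;
  cm_mur : forall (x : n) (u : m), cm_mu (actr cm_action u x) = cm_mu u <o> x;
  cm_mul : forall (x : n) (u : m), cm_mu (actl cm_action x u) = x <o> cm_mu u;
  cm_peifferl : forall u v : m, actl cm_action (cm_mu u) v = u <o> v;
  cm_peifferr : forall u v : m, actr cm_action u (cm_mu v) = u <o> v }.

Record cmExt (K : fieldType) (g : preLieAlg K) (V : lmodType K) := CMExt {
  ce_m : preLieAlg K;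
  ce_n : preLieAlg K;
  ce_cm : crossedModule ce_m ce_n;
  ce_i : plHom (trivialPL V) ce_m;
  ce_pi : plHom ce_n g;
  ce_i_inj : injective ce_i;
  ce_exact_m : forall u : ce_m, cm_mu ce_cm u = 0 <-> exists v, ce_i v = u;
  ce_exact_n : forall x : ce_n, ce_pi x = 0 <-> exists u, cm_mu ce_cm u = x;
  ce_pi_surj : forall x : g, exists y, ce_pi y = x }.

(* Sections exist, since K is a field; the equations do not depend on rho. *)
Definition induces (K : fieldType) (g : preLieAlg K) (V : lmodType K)
    (r : plRep g V) (E : cmExt g V) : Prop :=
  forall rho : {linear g -> ce_n E}, (forall x, ce_pi E (rho x) = x) ->
  forall (x : g) (u : V),
    ce_i E (actl r x u) = actl (ce_cm E) (rho x) (ce_i E u) /\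
    ce_i E (actr r u x) = actr (ce_cm E) (ce_i E u) (rho x).

Definition elem_equiv (K : fieldType) (g : preLieAlg K) (V : lmodType K)
    (E E' : cmExt g V) : Prop :=
  exists (r : plHom (ce_m E) (ce_m E')) (s : plHom (ce_n E) (ce_n E')),
  [/\ forall v, r (ce_i E v) = ce_i E' v,
      forall u, s (cm_mu (ce_cm E) u) = cm_mu (ce_cm E') (r u),
      forall x, ce_pi E' (s x) = ce_pi E x,
      forall x u, r (actr (ce_cm E) u x) = actr (ce_cm E') (r u) (s x)
    & forall x u, r (actl (ce_cm E) x u) = actl (ce_cm E') (s x) (r u)].

Definition cm_equiv (K : fieldType) (g : preLieAlg K) (V : lmodType K)
    (E E' : cmExt g V) : Prop :=
  clos_refl_sym_trans (cmExt g V) (@elem_equiv K g V) E E'.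

(* A class is encoded as the predicate of the extensions it contains; [induces]
   is invariant under [cm_equiv]. *)
Definition CExt (K : fieldType) (g : preLieAlg K) (V : lmodType K)
    (r : plRep g V) :=
  {C : cmExt g V -> Prop | exists2 E, induces r E & C = cm_equiv E}.

Record abExt (K : fieldType) (A : lieAlg K) (W : lmodType K)
    (r : lieRep A W) := AbExt {
  ab_hat : lieAlg K;
  ab_i : lieHom (abelianLie W) ab_hat;
  ab_p : lieHom ab_hat A;
  ab_i_inj : injective ab_i;
  ab_exact : forall y : ab_hat, ab_p y = 0 <-> exists w, ab_i w = y;
  ab_p_surj : forall x : A, exists y, ab_p y = x;
  ab_induces : forall (x : A) (y : ab_hat) (w : W),
    ab_p y = x -> [| y, ab_i w |] = ab_i (r x w) }.

Definition ab_equiv (K : fieldType) (A : lieAlg K) (W : lmodType K)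
    (r : lieRep A W) (E1 E2 : abExt r) : Prop :=
  exists gamma : lieHom (ab_hat E2) (ab_hat E1),
    (forall w, gamma (ab_i E2 w) = ab_i E1 w) /\
    (forall y, ab_p E1 (gamma y) = ab_p E2 y).

(* [ab_equiv] is an equivalence relation: any such gamma is bijective, by the
   five lemma. *)
Definition AExt (K : fieldType) (A : lieAlg K) (W : lmodType K)
    (r : lieRep A W) :=
  {C : abExt r -> Prop | exists E, C = ab_equiv E}.

Section HomModule.
Variables (K : fieldType) (g : preLieAlg K) (V : lmodType K) (r : plRep g V).

Section Action.
Variables (x : g) (f : {linear g -> V}).

Definition hom_act_fun (y : g) : V :=
  actl r x (f y) + actr r (f x) y - f (x <o> y).

Lemma hom_act_linear : linear hom_act_fun.
Proof.
move=> a y z; rewrite /hom_act_fun linearP !linearPr linearP /=.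
by rewrite scalerBr scalerDr opprD (addrACA (a *: _)) [LHS]addrACA.
Qed.

HB.instance Definition _ :=
  GRing.isLinear.Build K g V *:%R hom_act_fun hom_act_linear.

Definition hom_act : {linear g -> V} := hom_act_fun.
End Action.

Lemma hom_act_bilinear : bilinear_for *:%R *:%R hom_act.
Proof.
split=> [f|x] a.
  move=> x y; apply: linearP_ext => z.
  rewrite lin_addE lin_scaleE /= /hom_act_fun !linearPl linearP linearPl /=.
  by rewrite linearP /= scalerBr scalerDr opprD (addrACA (a *: _)) [LHS]addrACA.
move=> f h; apply: linearP_ext => z.
rewrite lin_addE lin_scaleE /= /hom_act_fun !lin_addE !lin_scaleE linearPr linearPl /=.
by rewrite scalerBr scalerDr opprD (addrACA (a *: _)) [LHS]addrACA.
Qed.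

HB.instance Definition _ := bilinear_isBilinear.Build K g {linear g -> V}
  {linear g -> V} *:%R *:%R hom_act hom_act_bilinear.

Lemma hom_actP (x y : subadjacent g) (f : {linear g -> V}) :
  hom_act [| x, y |] f = hom_act x (hom_act y f) - hom_act y (hom_act x f).
Proof.
apply: linearP_ext => z; rewrite lin_addE lin_oppE /= /hom_act_fun /=.
have actrE (a b c : g) : actr r (actr r (f a) b) c =
    actr r (actl r b (f a)) c - actl r b (actr r (f a) c) + actr r (f a) (b <o> c).
  by rewrite actrP subrK.
have mulE : pl_br x y <o> z = x <o> (y <o> z) - y <o> (x <o> z).
  by rewrite linearBl; apply/zmod_swap/pl_mulP.
rewrite actlP mulE /pl_br !(linearB f) /=.
rewrite !(linearBr, linearDr, linearBl, linearDl) /= !actrE.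
exact: zmod_hom.
Qed.

Definition homRep : lieRep (subadjacent g) {linear g -> V} :=
  @LieRep K (subadjacent g) {linear g -> V}
    (hom_act : {bilinear g -> {linear g -> V} -> {linear g -> V}}) hom_actP.

End HomModule.

(* Main.v *)
(* Both sides are classified by the second cohomology of the sub-adjacent Lie algebra with
   values in Hom(g, V).  For abelian extensions this is the usual choice of a linear section.
   For a crossed module extension, choose a linear section rho of pi and a bilinear lift
   alpha : g x g -> m of rho x o rho y - rho (x o y).  The product of n then lifts to a
   non-associative product on g x m, and its failure to be pre-Lie is a map
   theta : g x g x g -> V, which is a cocycle by a Bianchi identity and whose class does not
   depend on rho and alpha.

   Conversely, a non-associative product on g x M which is pre-Lie up to j theta, for an
   embedding j : V -> M whose image is an ideal, gives a crossed module extension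
   V -> M -> (g x M) / j V -> g with cocycle theta.  This is used twice.  If two extensions
   have the same cocycle, take M = m x m' and the diagonal j: the resulting extension maps to
   both, so they are equivalent.  To realize a given theta, take M = Hom(S(g), V), on which g
   acts by the dual of x . s = x s + L_x s; there theta becomes the coboundary of a cochain
   found degree by degree in S(g), by exactness of the Koszul complex (with an ordered basis
   of g, so that no assumption on the characteristic is needed). *)
From HB Require Import structures.
Require Import Defs.
From mathcomp Require Import all_boot all_algebra.
From mathcomp Require Import boolp classical_sets wochoice.
From Stdlib Require Import Relation_Operators.

Set Implicit Arguments.
Unset Strict Implicit.
Unset Printing Implicit Defensive.

Import GRing.Theory.
Local Open Scope classical_set_scope.
Local Open Scope ring_scope.

(** * Identities in abelian groups *)

Inductive zexp := ZVar of nat | ZZero | ZAdd of zexp & zexp | ZOpp of zexp.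

Fixpoint zcoefs_add (s t : seq int) : seq int :=
  match s, t with
  | [::], _ => t
  | _, [::] => s
  | c :: s', d :: t' => (c + d) :: zcoefs_add s' t'
  end.

Fixpoint zcoefs (t : zexp) : seq int :=
  match t with
  | ZVar n => ncons n 0 [:: 1]
  | ZZero => [::]
  | ZAdd a b => zcoefs_add (zcoefs a) (zcoefs b)
  | ZOpp a => [seq - c | c <- zcoefs a]
  end.

Section ZmodReflection.
Variable V : zmodType.

Fixpoint zeval (env : seq V) (t : zexp) : V :=
  match t with
  | ZVar n => env`_n
  | ZZero => 0
  | ZAdd a b => zeval env a + zeval env b
  | ZOpp a => - zeval env a
  end.

Fixpoint zcomb (env : seq V) (s : seq int) : V :=
  match env, s with
  | x :: env', c :: s' => x *~ c + zcomb env' s'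
  | _, _ => 0
  end.

Lemma zcombD env s t :
  zcomb env (zcoefs_add s t) = zcomb env s + zcomb env t.
Proof.
elim: s env t => [ |c s IH] [ |x env] [ |d t] //=; rewrite ?addr0 ?add0r //.
by rewrite IH mulrzDr addrACA.
Qed.

Lemma zcombN env s : zcomb env [seq - c | c <- s] = - zcomb env s.
Proof.
elim: s env => [ |c s IH] [ |x env] //=; rewrite ?oppr0 //.
by rewrite IH mulrNz opprD.
Qed.

Lemma zcomb_var env n : zcomb env (ncons n 0 [:: 1]) = env`_n.
Proof.
elim: n env => [ |n IH] [ |x env] //=; last by rewrite mulr0z add0r IH.
by case: env; rewrite /= addr0.
Qed.

Lemma zevalE env t : zeval env t = zcomb env (zcoefs t).
Proof.
elim: t => [n|/=|a IHa b IHb|a IHa] /=.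
- by rewrite zcomb_var.
- by case: env.
- by rewrite zcombD IHa IHb.
- by rewrite zcombN IHa.
Qed.

Lemma zcomb0 env s : all (pred1 0) s -> zcomb env s = 0.
Proof.
elim: s env => [ |c s IH] [ |x env] //= /andP[/eqP-> s0].
by rewrite mulr0z add0r IH.
Qed.

(** Both sides are integer combinations of the atoms in [env]. If the coefficients of the difference
    all compute to 0, the identity holds in every abelian group. *)
Lemma zmod_reflect (env : seq V) (a b : zexp) :
  all (pred1 0) (zcoefs (ZAdd a (ZOpp b))) -> zeval env a = zeval env b.
Proof.
move=> ab0; apply/eqP; rewrite -subr_eq0; apply/eqP.
by rewrite -[LHS]/(zeval env (ZAdd a (ZOpp b))) zevalE zcomb0.
Qed.

End ZmodReflection.

(* Atoms are compared syntactically by [zmod_syn] and up to conversion by [zmod]: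
   distinct canonical instances of the same operation have to be identified. *)
Ltac zmod_eq_syn x y :=
  match constr:(O) with
  | _ => let _ := match constr:(O) with _ => constr_eq x y end in constr:(true)
  | _ => constr:(false)
  end.

Ltac zmod_eq_conv x y :=
  match constr:(O) with
  | _ => let _ := match constr:(O) with _ => constr_eq x y end in constr:(true)
  | _ => let _ := match constr:(O) with _ => unify x y end in constr:(true)
  | _ => constr:(false)
  end.

Ltac zmod_find cmp x env :=
  lazymatch env with
  | ?y :: ?env' =>
      lazymatch cmp x y with
      | true => constr:(Some O)
      | false =>
          lazymatch zmod_find cmp x env' with
          | Some ?n => constr:(Some (S n))
          | None => constr:(@None nat)
          end
      end
  | _ => constr:(@None nat)
  end.

Ltac zmod_atoms cmp env t :=
  lazymatch t with
  | ?a + ?b => let env1 := zmod_atoms cmp env a in zmod_atoms cmp env1 b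
  | - ?a => zmod_atoms cmp env a
  | 0 => env
  | _ => lazymatch zmod_find cmp t env with
         | Some _ => env
         | None => constr:(t :: env)
         end
  end.

Ltac zmod_reify cmp env t :=
  lazymatch t with
  | ?a + ?b =>
      let ta := zmod_reify cmp env a in
      let tb := zmod_reify cmp env b in constr:(ZAdd ta tb)
  | - ?a => let ta := zmod_reify cmp env a in constr:(ZOpp ta)
  | 0 => constr:(ZZero)
  | _ => lazymatch zmod_find cmp t env with Some ?n => constr:(ZVar n) end
  end.

Ltac zmod_with cmp :=
  rewrite ?(scalerDr, scalerN);
  lazymatch goal with
  | |- @eq ?V ?a ?b =>
      let env0 := constr:(@nil V) in
      let env1 := zmod_atoms cmp env0 a in
      let env2 := zmod_atoms cmp env1 b in
      let ta := zmod_reify cmp env2 a in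
      let tb := zmod_reify cmp env2 b in
      exact (@zmod_reflect _ env2 ta tb (eq_refl true))
  end.

Ltac zmod_syn := zmod_with zmod_eq_syn.
Ltac zmod := first [zmod_syn | zmod_with zmod_eq_conv].

(** Derives a goal from a known equation with the same difference of sides; that the differences
    agree is left to [zmod]. *)
Lemma zmod_eq1 (V : zmodType) (x y p q : V) : p = q -> x - y = p - q -> x = y.
Proof. by move=> ->; rewrite subrr => /eqP; rewrite subr_eq0 => /eqP. Qed.

Lemma zmod_eq2 (V : zmodType) (x y p q p' q' : V) :
  p = q -> p' = q' -> x - y = (p - q) + (p' - q') -> x = y.
Proof. by move=> -> ->; rewrite !subrr addr0 => /eqP; rewrite subr_eq0 => /eqP. Qed.

Section Mk.
Variables (K : fieldType) (U V W : lmodType K).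

Definition mk_linear (f : U -> V) (fP : linear f) : {linear U -> V} :=
  HB.pack f (GRing.isLinear.Build K U V *:%R f fP).

Definition mk_bilinear (f : U -> V -> W) (fP : bilinear_for *:%R *:%R f) :
    {bilinear U -> V -> W} :=
  HB.pack f (bilinear_isBilinear.Build K U V W *:%R *:%R f fP).

Lemma mk_linearE f fP x : @mk_linear f fP x = f x. Proof. by []. Qed.
End Mk.

(** * Bases *)

Section Free.
Variables (K : fieldType) (M : lmodType K).
Implicit Types (S B : set M) (l : seq (K * M)).

Definition lcomb (U : lmodType K) (f : M -> U) l : U :=
  \sum_(p <- l) p.1 *: f p.2.

(** A list may repeat a vector, so the coefficient is collected over all occurrences. *)
Definition coef l (x : M) : K := \sum_(p <- l | p.2 == x) p.1.

Definition supported S l := forall p, p \in l -> S p.2.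

Definition free_set S :=
  forall l, supported S l -> lcomb id l = 0 -> forall x, coef l x = 0.

(** A basis in the form of its universal property; [free_spanning_basis] and [basis_free] relate it
    to coefficients. *)
Definition is_basis B :=
  (forall (U : lmodType K) (f : M -> U),
     exists F : {linear M -> U}, forall x, B x -> F x = f x) /\
  (forall (U : lmodType K) (F G : {linear M -> U}),
     (forall x, B x -> F x = G x) -> F =1 G).

Lemma lcomb_cat (U : lmodType K) (f : M -> U) l1 l2 :
  lcomb f (l1 ++ l2) = lcomb f l1 + lcomb f l2.
Proof. by rewrite /lcomb big_cat. Qed.

Lemma lcomb_scale (U : lmodType K) (f : M -> U) a l :
  lcomb f [seq (a * p.1, p.2) | p <- l] = a *: lcomb f l.
Proof.
by rewrite /lcomb big_map scaler_sumr; apply: eq_bigr => p _; rewrite scalerA.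
Qed.

Lemma supported_cat S l1 l2 :
  supported S l1 -> supported S l2 -> supported S (l1 ++ l2).
Proof. by move=> S1 S2 p; rewrite mem_cat => /orP[/S1|/S2]. Qed.

Lemma supported_scale S a l :
  supported S l -> supported S [seq (a * p.1, p.2) | p <- l].
Proof. by move=> Sl _ /mapP[p /Sl Sp ->]. Qed.

Lemma lcombE (U : lmodType K) (f : M -> U) l :
  lcomb f l = \sum_(x <- undup (map snd l)) coef l x *: f x.
Proof.
rewrite /lcomb /coef; under [RHS]eq_bigr do rewrite scaler_suml.
rewrite (exchange_big_dep predT) //= [LHS]big_seq [RHS]big_seq.
apply: eq_bigr => p pl; rewrite [RHS]big_mkcond (bigD1_seq p.2) /= ?undup_uniq //; last first.
  by rewrite mem_undup map_f.
by rewrite eqxx big1 ?addr0 // => x; rewrite eq_sym => /negbTE->.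
Qed.

Lemma free_lcomb0 S (U : lmodType K) (f : M -> U) l :
  free_set S -> supported S l -> lcomb id l = 0 -> lcomb f l = 0.
Proof.
move=> freeS Sl l0; rewrite lcombE big1 // => x _.
by rewrite (freeS _ Sl l0) scale0r.
Qed.

(** A function on [B] is extended through a chosen expansion [c v] of each vector; freeness makes
    the value independent of the expansion, hence linear in [v]. *)
Lemma free_spanning_basis B : free_set B ->
  (forall v, exists2 l, supported B l & v = lcomb id l) -> is_basis B.
Proof.
move=> freeB spanB; split=> [U f|U F G FG v]; last first.
  have [l Bl ->] := spanB v; rewrite /lcomb !linear_sum /=.
  by rewrite big_seq [RHS]big_seq; apply: eq_bigr => p /Bl Bp; rewrite !linearZ /= FG.
pose c v := sval (cid2 (spanB v)).
have cB v : supported B (c v) by rewrite /c; case: cid2.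
have cE v : lcomb id (c v) = v by rewrite /c; case: cid2.
have FE l v : supported B l -> lcomb id l = v -> lcomb f (c v) = lcomb f l.
  move=> Bl lv; apply/eqP; rewrite -subr_eq0 -scaleN1r -lcomb_scale -lcomb_cat.
  apply/eqP/(free_lcomb0 _ freeB).
    by apply: supported_cat => //; apply: supported_scale.
  by rewrite lcomb_cat lcomb_scale cE lv scaleN1r subrr.
have F_linear : linear (fun v => lcomb f (c v)).
  move=> a u v; rewrite -lcomb_scale -lcomb_cat; apply: FE.
    by apply: supported_cat => //; apply: supported_scale.
  by rewrite lcomb_cat lcomb_scale !cE.
exists (mk_linear F_linear) => x Bx; rewrite mk_linearE.
rewrite (FE [:: (1, x)]) /lcomb ?big_seq1 ?scale1r //.
by move=> p; rewrite inE => /eqP->.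
Qed.

(** Zorn's lemma for the sets [A] whose union with [S0] is free. *)
Lemma free_extends_to_basis S0 : free_set S0 -> exists2 B, is_basis B & S0 `<=` B.
Proof.
move=> free0.
(* A combination is finite, so one member of the chain together with [S0] supports it. The
   alternative [X = set0] covers combinations supported in [S0] alone, in particular for the empty
   chain. *)
have chain F : F `<=` [set A | free_set (A `|` S0)] -> total_on F subset ->
    free_set (\bigcup_(X in F) X `|` S0).
  move=> Ffree Ftot l Fl; pose P X := X = set0 \/ F X.
  suff [X PX Xl] : exists2 X, P X & supported (X `|` S0) l.
    by case: PX Xl => [->|FX]; [rewrite set0U; apply: free0|apply: Ffree].
  elim: l Fl => [ |p l IH] Fl; first by exists set0; [left| ].
  have [q ql|X PX Xl] := IH; first by apply: Fl; rewrite inE ql orbT.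
  have cons Y : (Y `|` S0) p.2 -> supported (Y `|` S0) l ->
      supported (Y `|` S0) (p :: l).
    by move=> Yp Yl q; rewrite inE => /predU1P[->|/Yl].
  have [[Y FY Yp]|S0p] := Fl p (mem_head _ _); last first.
    by exists X => //; apply: cons => //; right.
  case: PX => [X0|FX].
    exists Y; first by right.
    by apply: cons; [left|move=> q /Xl; rewrite X0 set0U; right].
  have [XY|YX] := Ftot _ _ FX FY.
    exists Y; first by right.
    by apply: cons; [left|move=> q /Xl[/XY| ]; [left|right]].
  by exists X; [right|apply: cons => //; left; apply: YX].
have [A [freeA maxA]] := Zorn_bigcup chain.
exists (A `|` S0); last by move=> x; right.
apply: free_spanning_basis => // v.
have [Bv|nBv] := pselect ((A `|` S0) v).
  exists [:: (1, v)]; first by move=> p; rewrite inE => /eqP->.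
  by rewrite /lcomb big_seq1 scale1r.
(* By maximality, adding [v] creates a nontrivial relation. Its coefficient at [v] is nonzero, since
   the other vectors are free; dividing by it expresses [v]. *)
have : ~ free_set ((A `|` [set v]) `|` S0).
  apply: maxA; split=> [x|sub]; [by left| ].
  by apply: nBv; left; apply: sub; right.
move=> /existsNP[l /not_implyP[Bl /not_implyP[l0 /existsNP[x xl]]]].
pose l' := [seq p <- l | p.2 != v].
have Bl' : supported (A `|` S0) l'.
  move=> p; rewrite mem_filter => /andP[/eqP pv /Bl[[Ap|//]|S0p]]; by [left|right].
have lE : coef l v *: v + lcomb id l' = 0.
  rewrite -l0 /lcomb [RHS](bigID (fun p => p.2 == v)) /= big_filter.
  congr (_ + _); rewrite /coef scaler_suml.
  by apply: eq_bigr => p /eqP->.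
have [cv0|cv0] := eqVneq (coef l v) 0.
  case: xl; have [-> //|xv] := eqVneq x v.
  rewrite cv0 scale0r add0r in lE; rewrite -(freeA _ Bl' lE x) /coef big_filter_cond.
  by apply: eq_bigl => p; case: (eqVneq p.2 x) => [->|_]; rewrite ?xv ?andbF.
exists [seq (- (coef l v)^-1 * p.1, p.2) | p <- l']; first exact: supported_scale.
have l'E : lcomb id l' = - (coef l v *: v) by apply/eqP; rewrite -addr_eq0 addrC lE.
by rewrite lcomb_scale l'E scaleNr scalerN opprK scalerA mulVf ?scale1r.
Qed.

Lemma basis_exists : exists B, is_basis B.
Proof.
have [B basisB _] : exists2 B, is_basis B & set0 `<=` B; last by exists B.
apply: free_extends_to_basis => l sl _ x.
by rewrite /coef big_seq_cond big1 // => p /andP[/sl].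
Qed.

(** The linear extension of the indicator of [x] sends the combination to [coef l x]. *)
Lemma basis_free B : is_basis B -> free_set B.
Proof.
move=> [ext _] l Bl l0 x.
have [F FE] := ext K^o (fun y => (y == x)%:R).
transitivity (F (lcomb id l)); last by rewrite l0 linear0.
rewrite /lcomb linear_sum /= /coef big_mkcond big_seq [RHS]big_seq.
apply: eq_bigr => p /Bl Bp; rewrite linearZ /= FE //.
by case: eqP => _; rewrite /GRing.scale /= ?mulr1 ?mulr0.
Qed.

End Free.

(** * Lifts and retractions of linear maps over a field *)

Section LinearMapFacts.
Variables (K : fieldType) (U V W : lmodType K).

(** Preimages are chosen on a basis of [W] and extended linearly. *)
Lemma linear_lift (f : {linear U -> V}) (h : {linear W -> V}) :
  (forall w, exists u, f u = h w) ->
  exists h' : {linear W -> U}, forall w, f (h' w) = h w.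
Proof.
move=> hf; have [B [ext uniq]] := basis_exists W.
have [h' h'E] := ext U (fun w => sval (cid (hf w))).
exists h' => w; apply: (uniq V (f \o h') h) => x Bx /=.
by rewrite h'E //; case: cid.
Qed.

(** The image of a basis of [U] is free, so it extends to a basis of [V]; on the latter, [t] is
    prescribed by a set-theoretic left inverse [j] of [i]. *)
Lemma linear_retraction (i : {linear U -> V}) :
  injective i -> exists t : {linear V -> U}, forall u, t (i u) = u.
Proof.
move=> i_inj; have [B basisB] := basis_exists U.
have freeB := basis_free basisB; have [ext uniq] := basisB.
have pinv v : exists u, forall w, i w = v -> u = w.
  have [[u iu]|no] := pselect (exists u, i u = v); last by exists 0 => w iw; case: no; exists w.
  by exists u => w; rewrite -iu => /i_inj.
pose j v := sval (cid (pinv v)).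
have jK u : j (i u) = u by rewrite /j; case: cid => w /= wu; apply: wu.
have [B' [ext' _] BB'] : exists2 B', is_basis B' & (i @` B)%classic `<=` B'.
  apply: free_extends_to_basis => l il l0.
  pose l' := [seq (p.1, j p.2) | p <- l].
  have lE : l = [seq (p.1, i p.2) | p <- l'].
    rewrite -map_comp -[LHS]map_id; apply/eq_in_map => -[a v] avl /=.
    by have [u _ /= <-] := il _ avl; rewrite jK.
  have l'0 : lcomb id l' = 0.
    apply: i_inj; rewrite linear0 -[RHS]l0 [in RHS]lE /lcomb [in RHS]big_map linear_sum /=.
    by apply: eq_bigr => p _; rewrite linearZ.
  have Bl' : supported B l'.
    by move=> _ /mapP[p /il[u Bu uv] ->] /=; rewrite -uv jK.
  move=> v; rewrite /coef lE; move: l' l'0 Bl' {lE} => l' l'0 Bl'; rewrite big_map /=.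
  have [[u iu]|no] := pselect (exists u, i u = v).
    rewrite -[RHS](freeB _ Bl' l'0 u) /coef; apply: eq_bigl => p.
    by rewrite -iu inj_eq.
  by rewrite big1 // => p /eqP ip; case: no; exists p.2.
have [t tE] := ext' U j.
exists t => u; apply: (uniq U (t \o i) idfun) => x Bx /=.
by rewrite tE ?jK //; apply: BB'; exists x.
Qed.

End LinearMapFacts.

(** [linear_lift] is applied twice: to each [h w], and then along composition with [f]. *)
Lemma linear_bilift (K : fieldType) (U V W X : lmodType K) (f : {linear U -> V})
    (h : {linear W -> {linear X -> V}}) :
  (forall w x, exists u, f u = h w x) ->
  exists h' : {linear W -> {linear X -> U}}, forall w x, f (h' w x) = h w x.
Proof.
move=> hf.
have fc_linear : linear (fun k : {linear X -> U} => f \o k : {linear X -> V}).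
  by move=> a k k'; apply: linearP_ext => x; rewrite /= linearP.
have [w|h' h'E] := @linear_lift _ _ _ _ (mk_linear fc_linear) h.
  have [k kE] := linear_lift (hf w).
  by exists k; apply: linearP_ext => x; rewrite -kE.
by exists h' => w x; rewrite -h'E.
Qed.

(** * Abelian extensions of Lie algebras *)

Section Curry.
Variables (K : fieldType) (U V W : lmodType K).

Lemma curry_linear (f : {bilinear U -> V -> W}) :
  linear (fun u => mk_linear (fun a x y => linearPr f u a x y)).
Proof. by move=> a u v; apply: linearP_ext => y; rewrite /= linearPl. Qed.

Definition curry_lin (f : {bilinear U -> V -> W}) :
  {linear U -> {linear V -> W}} := mk_linear (curry_linear f).

Implicit Types f : {linear U -> {linear V -> W}}.

Lemma lin2D f u u' v : f (u + u') v = f u v + f u' v.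
Proof. by rewrite linearD lin_addE. Qed.

Lemma lin2Z f a u v : f (a *: u) v = a *: f u v.
Proof. by rewrite linearZ lin_scaleE. Qed.

Lemma lin2_0 f v : f 0 v = 0. Proof. by rewrite linear0. Qed.

End Curry.

(** * The degree 2 cohomology class of an abelian extension *)

Section Cohomology.
Variables (K : fieldType) (A : lieAlg K) (W : lmodType K) (r : lieRep A W).
Implicit Types (lambda : {linear A -> W}) (theta : {linear A -> {linear A -> W}}).
Local Notation br := (lie_br _).

Lemma lie_brC (B : lieAlg K) (x y : B) : br x y = - br y x.
Proof.
apply/eqP; rewrite -addr_eq0; apply/eqP; have := lie_alt (x + y).
by rewrite linearDl !linearDr !lie_alt add0r addr0.
Qed.

Lemma lie_jacobiC (B : lieAlg K) (x y z : B) :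
  br (br x y) z + br (br y z) x + br (br z x) y = 0.
Proof.
rewrite !(lie_brC (br _ _)) -!opprD; apply/eqP.
by rewrite oppr_eq0 lie_jacobi.
Qed.

(** The Chevalley-Eilenberg differential of a 1-cochain. *)
Definition lie_d1_fun lambda x y := r x (lambda y) - r y (lambda x) - lambda (br x y).

Lemma lie_d1_bilinear lambda : bilinear_for *:%R *:%R (lie_d1_fun lambda).
Proof.
split=> u a x y; rewrite /lie_d1_fun.
  rewrite !(linearPl, linearPr, linearP) /=; zmod.
rewrite !(linearPl, linearPr, linearP) /=; zmod.
Qed.

Definition lie_d1 lambda : {linear A -> {linear A -> W}} :=
  curry_lin (mk_bilinear (lie_d1_bilinear lambda)).

Lemma lie_d1E lambda x y :
  lie_d1 lambda x y = r x (lambda y) - r y (lambda x) - lambda (br x y).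
Proof. by []. Qed.

Lemma lie_d1D lambda lambda' x y :
  lie_d1 (lambda + lambda') x y = lie_d1 lambda x y + lie_d1 lambda' x y.
Proof. by rewrite !lie_d1E !lin_addE !linearDr; zmod. Qed.

Definition alternating (U : lmodType K) (theta : {linear U -> {linear U -> W}}) :=
  forall x, theta x x = 0.

Lemma alternatingC (U : lmodType K) (theta : {linear U -> {linear U -> W}}) x y :
  alternating theta -> theta x y = - theta y x.
Proof.
move=> alt; apply/eqP; rewrite -addr_eq0; apply/eqP; have := alt (x + y).
by rewrite lin2D !linearD !alt add0r addr0.
Qed.

(** Chevalley-Eilenberg 2-cocycles, with closedness written as an equality of cyclic sums.
    Alternation is required instead of antisymmetry because of characteristic 2. *)
Definition lie_cocycle theta := alternating theta /\ forall x y z,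
  r x (theta y z) + r y (theta z x) + r z (theta x y) =
  theta (br x y) z + theta (br y z) x + theta (br z x) y.

Lemma lie_d1_cocycle lambda : lie_cocycle (lie_d1 lambda).
Proof.
split=> [x|x y z]; rewrite !lie_d1E; first by rewrite lie_alt linear0; zmod.
rewrite !linearBr /= !lie_actP.
have := congr1 lambda (lie_jacobiC x y z); rewrite !linearD linear0 /= => J.
apply/eqP; rewrite -subr_eq0 -J; apply/eqP; zmod.
Qed.



Lemma lie_cocycleB theta theta' :
  lie_cocycle theta -> lie_cocycle theta' -> lie_cocycle (theta - theta').
Proof.
move=> [alt1 closed1] [alt2 closed2]; split=> [x|x y z].
  by rewrite !(lin_addE, lin_oppE) alt1 alt2 subr0.
rewrite !(lin_addE, lin_oppE) !linearBr.
by apply: (zmod_eq2 (closed1 x y z) (esym (closed2 x y z))); zmod.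
Qed.

(** A cohomology class is handled as the set of its representatives, one for each linear section. *)
Definition has_lie_class (E : abExt r) theta :=
  exists s : {linear A -> ab_hat E}, (forall x, ab_p E (s x) = x) /\
    forall x y, br (s x) (s y) = s (br x y) + ab_i E (theta x y).

Lemma ab_iD (E : abExt r) (v w : W) : ab_i E (v + w) = ab_i E v + ab_i E w.
Proof. exact: (linearD (ab_i E)). Qed.

Lemma ab_iN (E : abExt r) (v : W) : ab_i E (- v) = - ab_i E v.
Proof. exact: (linearN (ab_i E)). Qed.

Lemma ab_iI (E : abExt r) (v w : W) : ab_i E v = ab_i E w -> v = w.
Proof. exact: ab_i_inj. Qed.

Lemma ab_p_i (E : abExt r) w : ab_p E (ab_i E w) = 0.
Proof. by apply/ab_exact; exists w. Qed.

Lemma ab_brl (E : abExt r) y w : br y (ab_i E w) = ab_i E (r (ab_p E y) w).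
Proof. exact: ab_induces. Qed.

Lemma ab_brr (E : abExt r) y w : br (ab_i E w) y = - ab_i E (r (ab_p E y) w).
Proof. by rewrite lie_brC ab_brl. Qed.

Lemma ab_br_i (E : abExt r) v w : br (ab_i E v) (ab_i E w) = 0.
Proof. by rewrite ab_brl ab_p_i linear0l linear0. Qed.

Lemma section_exists (U V : lmodType K) (p : {linear U -> V}) :
  (forall v, exists u, p u = v) ->
  exists s : {linear V -> U}, forall v, p (s v) = v.
Proof. by move=> psurj; have [s sP] := @linear_lift _ _ _ _ p idfun psurj; exists s. Qed.

(** Closedness is the Jacobi identity of the lifts [s x], [s y], [s z] minus the image under [s] of
    the Jacobi identity in [A]. *)
Lemma has_lie_class_exists (E : abExt r) :
  exists2 theta, lie_cocycle theta & has_lie_class E theta.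
Proof.
have [s sP] := section_exists (@ab_p_surj _ _ _ _ E).
have om_bilinear : bilinear_for *:%R *:%R (fun x y => br (s x) (s y) - s (br x y)).
  by split=> u a x y; rewrite !(linearPl, linearPr, linearP) /=; zmod.
have [x y|theta thetaE] := @linear_bilift _ _ _ _ _ (ab_i E)
    (curry_lin (mk_bilinear om_bilinear)).
  by apply/ab_exact; rewrite /= linearB /= lie_funM !sP subrr.
have brE x y : br (s x) (s y) = s (br x y) + ab_i E (theta x y).
  by rewrite thetaE /= addrC subrK.
exists theta; last by exists s.
have alt : alternating theta.
  by move=> x; apply: (@ab_iI E); rewrite thetaE /= !(lie_alt, linear0, subr0).
split=> // x y z; apply: (@ab_iI E).
have iE a b c : ab_i E (r a (theta b c)) =
    br (s a) (br (s b) (s c)) - s (br a (br b c)) + ab_i E (theta (br b c) a).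
  rewrite -{1}(sP a) -ab_brl thetaE /= linearBr /= (brE a (br b c)).
  rewrite (alternatingC _ _ alt) linearN; zmod.
have J := lie_jacobi (s x) (s y) (s z).
have := congr1 s (lie_jacobi x y z); rewrite linear0 !linearD /= => sJ.
rewrite ?ab_iD !iE; apply: (zmod_eq2 J (esym sJ)); zmod.
Qed.

Lemma lie_class_br (E : abExt r) theta (s : {linear A -> ab_hat E}) x y v w :
  (forall x, ab_p E (s x) = x) ->
  (forall x y, br (s x) (s y) = s (br x y) + ab_i E (theta x y)) ->
  br (s x + ab_i E v) (s y + ab_i E w) =
  s (br x y) + ab_i E (theta x y + r x w - r y v).
Proof.
move=> sP sE; rewrite linearDl !linearDr /= sE ab_br_i ab_brl ab_brr !sP.
by rewrite !(ab_iD, ab_iN); zmod.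
Qed.

(** Two sections differ by a linear map [lambda] into [W], and shifting a section by [lambda] adds
    [lie_d1 lambda] to its cocycle. *)
Lemma has_lie_class_coset (E : abExt r) theta theta' : has_lie_class E theta ->
  has_lie_class E theta' <->
  exists lambda, forall x y, theta' x y = theta x y + lie_d1 lambda x y.
Proof.
move=> [s [sP sE]]; split=> [[s' [s'P s'E]]|[lambda lambdaE]].
  have [x|lambda lE] := @linear_lift _ _ _ _ (ab_i E) (s' \- s).
    by apply/ab_exact; rewrite /= linearB /= sP s'P subrr.
  have {}lE x : s' x = s x + ab_i E (lambda x) by rewrite lE /= addrC subrK.
  exists lambda => x y; apply: (@ab_iI E); rewrite !(ab_iD, ab_iN).
  have := s'E x y; rewrite !lE (lie_class_br _ _ _ _ sP sE) !(ab_iD, ab_iN) => e.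
  by apply: (zmod_eq1 (esym e)); zmod.
have s'_linear : linear (fun x => s x + ab_i E (lambda x)).
  move=> a x y; rewrite (linearP s) (linearP lambda) (linearP (ab_i E)) /=.
  by zmod.
exists (mk_linear s'_linear); split=> [x|x y] /=.
  by rewrite linearD /= sP ab_p_i addr0.
rewrite (lie_class_br _ _ _ _ sP sE) lambdaE lie_d1E.
by rewrite !(ab_iD, ab_iN); zmod.
Qed.

(** An equivalence transports sections. Conversely, two sections with the same cocycle give the
    homomorphism sending [s x + ab_i E2 w] to [s1 x + ab_i E1 w]. *)
Lemma ab_equiv_class (E1 E2 : abExt r) theta : has_lie_class E2 theta ->
  ab_equiv E1 E2 <-> has_lie_class E1 theta.
Proof.
move=> [s [sP sE]]; split=> [[gamma [gi gp]]|[s1 [s1P s1E]]].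
  exists (gamma \o s); split=> [x|x y] /=; first by rewrite gp sP.
  by rewrite -lie_funM sE linearD gi.
have [t tE] := linear_retraction (@ab_i_inj _ _ _ _ E2).
(* The retraction [t] reads off the component in [W] after the part along the section is removed. *)
pose g : {linear ab_hat E2 -> ab_hat E1} :=
  (s1 \o ab_p E2) \+ (ab_i E1 \o (t \o (idfun \- (s \o ab_p E2)))).
have yE y : exists w, y = s (ab_p E2 y) + ab_i E2 w.
  have [w wE] : exists w, ab_i E2 w = y - s (ab_p E2 y).
    by apply/ab_exact; rewrite linearB sP subrr.
  by exists w; rewrite wE addrC subrK.
have gE x w : g (s x + ab_i E2 w) = s1 x + ab_i E1 w.
  by rewrite /= linearD /= sP ab_p_i addr0 [s x + _]addrC addrK tE.
have gM x y : g (br x y) = br (g x) (g y).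
  have [v ->] := yE x; have [w ->] := yE y; set x' := ab_p _ x; set y' := ab_p _ y.
  by rewrite (lie_class_br _ _ _ _ sP sE) !gE (lie_class_br _ _ _ _ s1P s1E).
exists (LieHom gM); split=> [w|y].
  by have := gE 0 w; rewrite !linear0 !add0r.
by have [w {1}->] := yE y; rewrite gE linearD s1P ab_p_i addr0.
Qed.

End Cohomology.

(** * The abelian extension defined by a 2-cocycle *)

Section ExtensionOfCocycle.
Variables (K : fieldType) (A : lieAlg K) (W : lmodType K) (r : lieRep A W).
Variables (theta : {linear A -> {linear A -> W}}) (thetaP : lie_cocycle r theta).
Local Notation br := (lie_br _).

Definition ext_br (a b : W * A) : W * A :=
  (theta a.2 b.2 + r a.2 b.1 - r b.2 a.1, br a.2 b.2).

Lemma ext_br_bilinear : bilinear_for *:%R *:%R ext_br.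
Proof.
split=> u a x y; congr pair; rewrite /= ?(linearPl, linearPr) //.
  rewrite lin2D lin2Z /= ; zmod.
rewrite linearD linearZ /=; zmod.
Qed.

Lemma ext_alt a : mk_bilinear ext_br_bilinear a a = 0.
Proof. by congr pair; rewrite /= ?lie_alt // thetaP.1 add0r subrr. Qed.

Lemma ext_jacobi a b c : let b' := mk_bilinear ext_br_bilinear in
  b' a (b' b c) + b' b (b' c a) + b' c (b' a b) = 0.
Proof.
case: a b c => [u x] [v y] [w z]; congr pair => /=; last exact: lie_jacobi.
rewrite !(linearDr, linearNr, lie_actP) /=.
rewrite !(alternatingC _ (br _ _) thetaP.1).
apply: (zmod_eq1 (thetaP.2 x y z)); zmod.
Qed.

Definition cocycle_lie : lieAlg K := LieAlg ext_alt ext_jacobi.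

Lemma ext_i_linear : linear (fun w : W => (w, 0) : W * A).
Proof. by move=> a u v; congr pair; rewrite /= scaler0 addr0. Qed.

Lemma ext_i_hom (v w : abelianLie W) :
  (mk_linear ext_i_linear : {linear abelianLie W -> cocycle_lie}) (br v w) =
  br (mk_linear ext_i_linear v : cocycle_lie) (mk_linear ext_i_linear w).
Proof. by congr pair; rewrite /= ?(lin2_0, linear0l, addr0, subr0). Qed.

Lemma ext_p_hom (a b : cocycle_lie) :
  (snd : {linear cocycle_lie -> A}) (br a b) = br (snd a) (snd b).
Proof. by []. Qed.

Lemma ext_i_inj : injective (LieHom ext_i_hom).
Proof. by move=> u v []. Qed.

Lemma ext_exact (a : cocycle_lie) :
  LieHom ext_p_hom a = 0 <-> exists w, LieHom ext_i_hom w = a.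
Proof. by split=> [/= a0|[w <-]//]; exists a.1; rewrite [RHS]surjective_pairing a0. Qed.

Lemma ext_p_surj (x : A) : exists a, LieHom ext_p_hom a = x.
Proof. by exists (0, x). Qed.

Lemma ext_induces (x : A) (a : cocycle_lie) (w : W) :
  LieHom ext_p_hom a = x ->
  br a (LieHom ext_i_hom w) = LieHom ext_i_hom (r x w).
Proof.
by move=> /= <-; congr pair; rewrite /= ?(linear0r, linear0l, linear0, add0r, subr0).
Qed.

Definition cocycle_ext : abExt r :=
  AbExt ext_i_inj ext_exact ext_p_surj ext_induces.

Lemma ext_s_linear : linear (fun x : A => (0, x) : W * A).
Proof. by move=> a u v; congr pair; rewrite /= scaler0 addr0. Qed.

Lemma cocycle_ext_class : has_lie_class cocycle_ext theta.
Proof.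
exists (mk_linear ext_s_linear); split=> // x y.
by congr pair; rewrite /= ?(linear0, addr0, add0r, subr0).
Qed.

End ExtensionOfCocycle.

(** * Crossed modules from algebras that are pre-Lie up to a cocycle *)

Section LinearKernel.
Variables (K : fieldType) (U V : lmodType K) (f : {linear U -> V}).

Record lin_ker := LinKer { ker_val :> U; ker_valP : f ker_val = 0 }.

Lemma ker_val_inj : injective ker_val.
Proof.
by move=> [u fu] [v fv] /= uv; subst v; rewrite (Prop_irrelevance fu fv).
Qed.

HB.instance Definition _ := gen_eqMixin lin_ker.
HB.instance Definition _ := gen_choiceMixin lin_ker.

Lemma ker_addP (u v : lin_ker) : f (ker_val u + ker_val v) = 0.
Proof. by rewrite linearD !ker_valP addr0. Qed.
Lemma ker_oppP (u : lin_ker) : f (- ker_val u) = 0.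
Proof. by rewrite linearN ker_valP oppr0. Qed.
Lemma ker_scaleP a (u : lin_ker) : f (a *: ker_val u) = 0.
Proof. by rewrite linearZ /= ker_valP scaler0. Qed.

Definition ker_zero := LinKer (linear0 f).
Definition ker_add u v := LinKer (ker_addP u v).
Definition ker_opp u := LinKer (ker_oppP u).
Definition ker_scale a u := LinKer (ker_scaleP a u).

Lemma ker_addA : associative ker_add.
Proof. by move=> u v w; apply: ker_val_inj; rewrite /= addrA. Qed.
Lemma ker_addC : commutative ker_add.
Proof. by move=> u v; apply: ker_val_inj; rewrite /= addrC. Qed.
Lemma ker_add0 : left_id ker_zero ker_add.
Proof. by move=> u; apply: ker_val_inj; rewrite /= add0r. Qed.
Lemma ker_addN : left_inverse ker_zero ker_opp ker_add.
Proof. by move=> u; apply: ker_val_inj; rewrite /= addNr. Qed.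

HB.instance Definition _ :=
  GRing.isZmodule.Build lin_ker ker_addA ker_addC ker_add0 ker_addN.

Lemma ker_scaleA a b u : ker_scale a (ker_scale b u) = ker_scale (a * b) u.
Proof. by apply: ker_val_inj; rewrite /= scalerA. Qed.
Lemma ker_scale1 : left_id 1 ker_scale.
Proof. by move=> u; apply: ker_val_inj; rewrite /= scale1r. Qed.
Lemma ker_scaleDr : right_distributive ker_scale +%R.
Proof. by move=> a u v; apply: ker_val_inj; rewrite /= scalerDr. Qed.
Lemma ker_scaleDl u : {morph ker_scale^~ u : a b / a + b}.
Proof. by move=> a b; apply: ker_val_inj; rewrite /= scalerDl. Qed.

HB.instance Definition _ :=
  GRing.Zmodule_isLmodule.Build K lin_ker
    ker_scaleA ker_scale1 ker_scaleDr ker_scaleDl.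

Lemma ker_val_linear : linear ker_val. Proof. by []. Qed.
HB.instance Definition _ := GRing.isLinear.Build K lin_ker U *:%R ker_val ker_val_linear.

End LinearKernel.

(* [mul] makes [g * M] a non-associative algebra over [g] that is pre-Lie up to
   [j theta]; dividing by [j V] gives the top algebra of a crossed module with base [M].
   The quotient is realized as the kernel of the retraction [t] of [j]. *)
Section QuotientExtension.
Variables (K : fieldType) (g : preLieAlg K) (V : lmodType K) (r : plRep g V).
Variables (M : lmodType K).
Let P : lmodType K := (g * M)%type.
Variables (mul : {bilinear P -> P -> P}) (j : {linear V -> M}) (t : {linear M -> V}).
Variable theta : {linear g -> {linear g -> {linear g -> V}}}.
Hypothesis tj : forall v, t (j v) = v.
Hypothesis mul1 : forall a b, (mul a b).1 = a.1 <o> b.1.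
Hypothesis mulj : forall a v, mul a (0, j v) = (0, j (actl r a.1 v)).
Hypothesis jmul : forall a v, mul (0, j v) a = (0, j (actr r v a.1)).
Hypothesis mulP : forall a b c,
  mul a (mul b c) - mul (mul a b) c - mul b (mul a c) + mul (mul b a) c =
  (0, j (theta a.1 b.1 c.1)).

Definition lm (a : P) (u : M) : M := (mul a (0, u)).2.
Definition rm (u : M) (a : P) : M := (mul (0, u) a).2.

Lemma mulM a u : mul a (0, u) = (0, lm a u).
Proof. by rewrite [LHS]surjective_pairing mul1 linear0r. Qed.

Lemma Mmul a u : mul (0, u) a = (0, rm u a).
Proof. by rewrite [LHS]surjective_pairing mul1 linear0l. Qed.

Lemma pairM (u v : M) a : (0, a *: u + v) = a *: (0, u) + (0, v) :> P.
Proof. by congr pair; rewrite /= scaler0 addr0. Qed.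

Lemma lm_bilinear : bilinear_for *:%R *:%R lm.
Proof. by split=> u a x y; rewrite /lm ?pairM ?(linearPl, linearPr). Qed.

Lemma rm_bilinear : bilinear_for *:%R *:%R rm.
Proof. by split=> u a x y; rewrite /rm ?pairM ?(linearPl, linearPr). Qed.

Let lmB := mk_bilinear lm_bilinear.
Let rmB := mk_bilinear rm_bilinear.

(** An argument in [0 * M] kills [theta], so the pre-Lie identity holds exactly there. Placing [M]
    in the third slot, the second slot or the first two gives this lemma, [lm_rm] and [rm_rm], from
    which the axioms of representation and action follow. *)
Lemma lm_lm a b u : lm a (lm b u) - lm (mul a b) u - lm b (lm a u) + lm (mul b a) u = 0.
Proof.
by have /(congr1 snd) := mulP a b (0, u); rewrite !mulM /= !linear0.
Qed.

Lemma lm_rm a u c : lm a (rm u c) - rm (lm a u) c - rm u (mul a c) + rm (rm u a) c = 0.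
Proof.
have /(congr1 snd) := mulP a (0, u) c.
have -> : theta a.1 (0, u).1 c.1 = 0 by rewrite linear0.
by rewrite !(Mmul c) !mulM !Mmul /= linear0.
Qed.

Lemma rm_rm u v c : lm (0, u) (rm v c) - rm (lm (0, u) v) c - lm (0, v) (rm u c)
   + rm (lm (0, v) u) c = 0.
Proof.
have /(congr1 snd) := mulP (0, u) (0, v) c.
have -> : theta (0, u).1 (0, v).1 c.1 = 0 by rewrite !linear0.
by rewrite !(Mmul c) !mulM !Mmul /= linear0.
Qed.

Definition base_mul (u v : M) : M := lm (0, u) v.

Lemma base_mul_bilinear : bilinear_for *:%R *:%R base_mul.
Proof. by split=> u a x y; rewrite /base_mul /lm ?pairM ?(linearPl, linearPr). Qed.

Lemma base_mulP u v w : let m := mk_bilinear base_mul_bilinear in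
  m (m u v) w - m u (m v w) = m (m v u) w - m v (m u w).
Proof.
rewrite /= /base_mul; apply: (zmod_eq1 (esym (lm_lm (0, u) (0, v) w))).
by rewrite !mulM; zmod.
Qed.

Definition base_pl : preLieAlg K := PreLieAlg base_mulP.

Definition top_ker : {linear P -> V} := t \o (@snd g M).
Definition top : lmodType K := lin_ker top_ker.

Lemma top_projP (a : P) : top_ker (a - (0, j (t a.2))) = 0.
Proof. by rewrite /= linearB /= tj subrr. Qed.

Definition top_proj_fun (a : P) : top := LinKer (top_projP a).

Lemma top_proj_linear : linear top_proj_fun.
Proof.
move=> a x y; apply: ker_val_inj; congr pair => /=; last by rewrite (linearP t) (linearP j); zmod.
by rewrite !subr0.
Qed.

Definition top_proj : {linear P -> top} := mk_linear top_proj_linear.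

Lemma top_projE a : ker_val (top_proj a) = a - (0, j (t a.2)). Proof. by []. Qed.

Lemma top_projK (x : top) : top_proj (ker_val x) = x.
Proof.
by apply: ker_val_inj; rewrite top_projE; case: x => x /= ->; rewrite linear0 subr0.
Qed.

Lemma top_proj_j v : top_proj (0, j v) = 0.
Proof. by apply: ker_val_inj; rewrite top_projE /= tj subrr. Qed.

(** [j V] is an ideal by [mulj] and [jmul], so changing a factor modulo [j V] does not affect the
    projected product. *)
Lemma top_proj_mull a b : top_proj (mul (ker_val (top_proj a)) b) = top_proj (mul a b).
Proof. by rewrite top_projE linearBl jmul (linearB top_proj) [X in _ - X]top_proj_j subr0. Qed.

Lemma top_proj_mulr a b : top_proj (mul a (ker_val (top_proj b))) = top_proj (mul a b).
Proof. by rewrite top_projE linearBr mulj (linearB top_proj) [X in _ - X]top_proj_j subr0. Qed.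

Definition top_mul (x y : top) : top := top_proj (mul (ker_val x) (ker_val y)).

Lemma top_mul_bilinear : bilinear_for *:%R *:%R top_mul.
Proof.
by split=> u a x y; rewrite /top_mul linearP ?(linearPl, linearPr) linearP.
Qed.

(** The defect [j theta] dies in the quotient by [j V]. *)
Lemma top_mulP x y z : let m := mk_bilinear top_mul_bilinear in
  m (m x y) z - m x (m y z) = m (m y x) z - m y (m x z).
Proof.
rewrite /= /top_mul !(top_proj_mull, top_proj_mulr).
have := congr1 top_proj (mulP x y z).
rewrite top_proj_j !(linearD top_proj, linearN top_proj) => e.
by apply: (zmod_eq1 (esym e)); zmod.
Qed.

Definition top_pl : preLieAlg K := PreLieAlg top_mulP.

(** [j V] annihilates [M], whose elements have zero component in [g]; hence the actions on [M]
    descend to the quotient. *)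
Lemma lm_proj a u : lm (ker_val (top_proj a)) u = lm a u.
Proof. by rewrite /lm top_projE linearBl jmul /= linear0r linear0 subr0. Qed.

Lemma rm_proj a u : rm u (ker_val (top_proj a)) = rm u a.
Proof. by rewrite /rm top_projE linearBr mulj /= linear0l linear0 subr0. Qed.

Definition top_actl (x : top_pl) (u : base_pl) : base_pl := lm (ker_val x) u.
Definition top_actr (u : base_pl) (x : top_pl) : base_pl := rm u (ker_val x).

Lemma top_actl_bilinear : bilinear_for *:%R *:%R top_actl.
Proof.
split=> u a x y; rewrite /top_actl; first exact: (linearPl lmB).
exact: (linearPr lmB).
Qed.

Lemma top_actr_bilinear : bilinear_for *:%R *:%R top_actr.
Proof.
split=> u a x y; rewrite /top_actr; first exact: (linearPl rmB).
exact: (linearPr rmB).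
Qed.

Lemma top_actlP (x y : top_pl) (u : base_pl) : let l := mk_bilinear top_actl_bilinear in
  l (pl_br x y) u = l x (l y u) - l y (l x u).
Proof.
rewrite /pl_br linearBl /= /top_mul /top_actl !lm_proj.
by apply: (zmod_eq1 (esym (lm_lm x y u))); zmod.
Qed.

Lemma top_actrP (x y : top_pl) (u : base_pl) :
  let l := mk_bilinear top_actl_bilinear in let r := mk_bilinear top_actr_bilinear in
  r (l x u) y - l x (r u y) = r (r u x) y - r u (x <o> y).
Proof.
rewrite /= /top_mul /top_actl /top_actr rm_proj.
by apply: (zmod_eq1 (esym (lm_rm x u y))); zmod.
Qed.

Definition top_rep : plRep top_pl base_pl := PLRep top_actlP top_actrP.

Lemma top_actionlP (x : top_pl) (u v : base_pl) :
  actl top_rep x u <o> v - actl top_rep x (u <o> v) =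
  actr top_rep u x <o> v - u <o> actl top_rep x v.
Proof.
rewrite /= /top_actl /top_actr /base_mul.
have := lm_rm x u (0, v); rewrite /rm !mulM /= => e.
by apply: (zmod_eq1 (esym e)); zmod.
Qed.

Lemma top_actionrP (x : top_pl) (u v : base_pl) :
  actr top_rep (u <o> v) x - u <o> actr top_rep v x =
  actr top_rep (v <o> u) x - v <o> actr top_rep u x.
Proof.
rewrite /= /top_actr /base_mul.
by apply: (zmod_eq1 (esym (rm_rm u v x))); zmod.
Qed.

Definition top_action : plAction top_pl base_pl := PLAction top_actionlP top_actionrP.

Lemma top_mu_linear : linear (fun u : M => top_proj (0, u)).
Proof. by move=> a u v; rewrite pairM linearP. Qed.

Lemma top_mu_hom (u v : base_pl) :
  (mk_linear top_mu_linear : {linear base_pl -> top_pl}) (u <o> v) =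
  (mk_linear top_mu_linear u : top_pl) <o> (mk_linear top_mu_linear v).
Proof. by rewrite /= /top_mul top_proj_mull top_proj_mulr mulM. Qed.

Definition top_mu : plHom base_pl top_pl := PLHom top_mu_hom.

Lemma top_mu_actr (x : top_pl) (u : base_pl) :
  top_mu (actr top_action u x) = top_mu u <o> x.
Proof. by rewrite /= /top_mul top_proj_mull Mmul. Qed.

Lemma top_mu_actl (x : top_pl) (u : base_pl) :
  top_mu (actl top_action x u) = x <o> top_mu u.
Proof. by rewrite /= /top_mul top_proj_mulr mulM. Qed.

Lemma top_peifferl (u v : base_pl) : actl top_action (top_mu u) v = u <o> v.
Proof. exact: lm_proj. Qed.

Lemma top_peifferr (u v : base_pl) : actr top_action u (top_mu v) = u <o> v.
Proof. exact: rm_proj. Qed.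

Definition top_cm : crossedModule base_pl top_pl :=
  CrossedModule top_mu_actr top_mu_actl top_peifferl top_peifferr.

Lemma top_i_hom (v w : trivialPL V) :
  (j : {linear trivialPL V -> base_pl}) (v <o> w) =
  (j v : base_pl) <o> j w.
Proof. by rewrite /= /base_mul /lm mulj /= linear0l linear0. Qed.

Lemma top_pi_hom (x y : top_pl) :
  ((@fst g M) \o (@ker_val _ _ _ top_ker) : {linear top_pl -> g}) (x <o> y) =
  (ker_val x).1 <o> (ker_val y).1.
Proof. by rewrite /= subr0 mul1. Qed.

Lemma top_exact_m (u : base_pl) :
  cm_mu top_cm u = 0 <-> exists v, PLHom top_i_hom v = u.
Proof.
split=> [/(congr1 (@ker_val _ _ _ _))|[v <-]]; last exact: top_proj_j.
move=> /(congr1 snd) /= /eqP; rewrite subr_eq0 => /eqP ujt.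
by exists (t u).
Qed.

Lemma top_exact_n (x : top_pl) :
  PLHom top_pi_hom x = 0 <-> exists u, cm_mu top_cm u = x.
Proof.
split=> [/= x0|[u <-]]; last by rewrite /= subr0.
by exists (ker_val x).2; rewrite /= -[RHS]top_projK [ker_val x]surjective_pairing x0.
Qed.

Lemma top_pi_surj (x : g) : exists y, PLHom top_pi_hom y = x.
Proof. by exists (top_proj (x, 0)); rewrite /= subr0. Qed.

Lemma top_i_inj : injective (PLHom top_i_hom).
Proof. exact: can_inj tj. Qed.

Definition quotient_ext : cmExt g V :=
  CMExt top_i_inj top_exact_m top_exact_n top_pi_surj.

End QuotientExtension.

(** * The cocycle of a crossed module extension *)

Lemma pair_ext (U V : Type) (a b : U * V) : a.1 = b.1 -> a.2 = b.2 -> a = b.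
Proof. by case: a b => [? ?] [? ?] /= -> ->. Qed.

Section Curvature.
Variables (K : fieldType) (P : lmodType K) (mul : {bilinear P -> P -> P}).

(* Vanishes iff [mul] is pre-Lie. *)
Definition curv (a b c : P) : P :=
  mul a (mul b c) - mul (mul a b) c - mul b (mul a c) + mul (mul b a) c.

Lemma curvDl a a' b c : curv (a + a') b c = curv a b c + curv a' b c.
Proof. by rewrite /curv !(linearDl, linearDr) /=; zmod. Qed.

Lemma curvC a b c : curv a b c = - curv b a c.
Proof. by rewrite /curv; zmod. Qed.

Lemma curvDm a b b' c : curv a (b + b') c = curv a b c + curv a b' c.
Proof. by rewrite !(curvC a) curvDl opprD. Qed.

Lemma curvDr a b c c' : curv a b (c + c') = curv a b c + curv a b c'.
Proof. by rewrite /curv !(linearDl, linearDr) /=; zmod. Qed.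

Let br a b := mul a b - mul b a.

(* The Jacobi identity of the left multiplications, together with the expression of
   the Jacobiator of [br] as the cyclic sum of [curv]. *)
Lemma curv_bianchi a b c d :
  (mul a (curv b c d) + mul (curv b c a) d - curv b c (mul a d)) +
  (mul b (curv c a d) + mul (curv c a b) d - curv c a (mul b d)) +
  (mul c (curv a b d) + mul (curv a b c) d - curv a b (mul c d)) =
  curv (br a b) c d + curv (br b c) a d + curv (br c a) b d.
Proof.
have mDl x y z : mul (x + y) z = mul x z + mul y z by rewrite linearDl.
have mDr x y z : mul x (y + z) = mul x y + mul x z by rewrite linearDr.
have mNl x z : mul (- x) z = - mul x z by rewrite linearNl.
have mNr x y : mul x (- y) = - mul x y by rewrite linearNr.
rewrite /curv /br !(mDl, mDr, mNl, mNr).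
zmod.
Qed.

End Curvature.

(** * The product on [g * m] defined by a section and a lift *)

Section LiftAlgebra.
Variables (K : fieldType) (g m n : preLieAlg K) (cm : crossedModule m n).
Variables (rho : {linear g -> n}) (alpha : {linear g -> {linear g -> m}}).

Definition is_lift :=
  forall x y, cm_mu cm (alpha x y) = rho x <o> rho y - rho (x <o> y).

(** The component in [m] of the curvature of [lift_mul] on elements of [g], written out; see
    [curv_lift]. *)
Definition lift_d (x y z : g) : m :=
  (actl cm (rho x) (alpha y z) + alpha x (y <o> z))
  - (actr cm (alpha x y) (rho z) + alpha (x <o> y) z)
  - (actl cm (rho y) (alpha x z) + alpha y (x <o> z))
  + (actr cm (alpha y x) (rho z) + alpha (y <o> x) z).

Definition lift_map (a : g * m) : n := rho a.1 + cm_mu cm a.2.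

(** A lift of the product of [n] along [lift_map]; [alpha] compensates for [rho] not being
    multiplicative. *)
Definition lift_mul_fun (a b : g * m) : g * m :=
  (a.1 <o> b.1,
   actl cm (rho a.1) b.2 + actr cm a.2 (rho b.1) + a.2 <o> b.2 + alpha a.1 b.1).

Lemma lift_mul_bilinear : bilinear_for *:%R *:%R lift_mul_fun.
Proof.
split=> u a x y; congr pair => /=; rewrite ?(linearPl, linearPr) //.
  rewrite (linearP rho) lin2D lin2Z /= !(linearPl, linearPr) /=; zmod.
rewrite (linearP rho) !(linearPl, linearPr) /= linearP; zmod.
Qed.

Definition lift_mul := mk_bilinear lift_mul_bilinear.

Lemma lift_mulM a u : lift_mul a (0, u) = (0, actl cm (lift_map a) u).
Proof.
congr pair => /=; rewrite ?linear0r // /lift_map linearDl /= cm_peifferl.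
by rewrite ?(linear0, linear0r, addr0).
Qed.

Lemma lift_Mmul a u : lift_mul (0, u) a = (0, actr cm u (lift_map a)).
Proof.
congr pair => /=; rewrite ?linear0l // /lift_map linearDr /= cm_peifferr.
by rewrite ?(linear0, linear0l, lin2_0, addr0, add0r).
Qed.

Hypothesis liftP : is_lift.

Lemma lift_map_mul a b : lift_map (lift_mul a b) = lift_map a <o> lift_map b.
Proof.
rewrite /lift_map /= !linearD /= liftP cm_mur cm_mul pl_funM.
by rewrite !linearDl /=; zmod.
Qed.

(** A product with [(0, w)] sees the other factor only through [lift_map], which is multiplicative;
    the claim becomes an axiom of the action of [n] on [m]. The same holds for the other slots. *)
Lemma curv_lift_r a b w : curv lift_mul a b (0, w) = 0.
Proof.
rewrite /curv !lift_mulM !lift_map_mul; apply: pair_ext => /=; first by rewrite !subr0 addr0.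
have := actlP cm (lift_map a) (lift_map b) w; rewrite linearBl /= => e.
by apply: (zmod_eq1 (esym e)); zmod.
Qed.

Lemma curv_lift_m a v c : curv lift_mul a (0, v) c = 0.
Proof.
rewrite /curv !(lift_Mmul c) !lift_mulM !lift_Mmul !lift_map_mul.
apply: pair_ext => /=; first by rewrite !subr0 addr0.
have e := actrP cm (lift_map a) (lift_map c) v.
by apply: (zmod_eq1 (esym e)); zmod.
Qed.

Lemma curv_lift_l u b c : curv lift_mul (0, u) b c = 0.
Proof. by rewrite curvC curv_lift_m oppr0. Qed.

Lemma curv_lift a b c : curv lift_mul a b c = (0, lift_d a.1 b.1 c.1).
Proof.
have split2 (e : g * m) : e = (e.1, 0) + (0, e.2).
  by case: e => e1 e2; apply: pair_ext; rewrite /= ?addr0 ?add0r.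
rewrite {1}(split2 a) {1}(split2 b) {1}(split2 c) curvDl curv_lift_l addr0.
rewrite curvDm curv_lift_m addr0 curvDr curv_lift_r addr0.
apply: pair_ext => /=.
  have := pl_mulP a.1 b.1 c.1 => e.
  by apply: (zmod_eq1 (esym e)); zmod.
by rewrite /lift_d !(linear0l, linear0r, linear0, addr0, add0r).
Qed.

(** [lift_map] is multiplicative with values in a pre-Lie algebra, so it kills the curvature. *)
Lemma lift_d_ker x y z : cm_mu cm (lift_d x y z) = 0.
Proof.
have := congr1 lift_map (curv_lift (x, 0) (y, 0) (z, 0)).
rewrite /lift_map linear0 add0r -/(lift_map _) => <-.
rewrite /curv.
have lD a b : lift_map (a + b) = lift_map a + lift_map b.
  by rewrite /lift_map !linearD /=; zmod.
have lN a : lift_map (- a) = - lift_map a.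
  by rewrite /lift_map !linearN /=; zmod.
rewrite !(lD, lN) !lift_map_mul.
set X := lift_map (x, 0); set Y := lift_map (y, 0); set Z := lift_map (z, 0).
by apply: (zmod_eq1 (esym (pl_mulP X Y Z))); zmod.
Qed.

End LiftAlgebra.

Ltac lin_expand :=
  rewrite !(linearPl, linearPr, linearP, lin_addE, lin_scaleE, lin_oppE) /=.

(** * Independence of the section *)

Section ChangeOfLift.
Variables (K : fieldType) (g m n : preLieAlg K) (cm : crossedModule m n).
Variables (rho : {linear g -> n}) (alpha : {linear g -> {linear g -> m}}).
Hypothesis liftP : is_lift cm rho alpha.
Variable b : {linear g -> m}.

Definition shift_rho : {linear g -> n} := rho \+ (cm_mu cm \o b).

(** Chosen so that the shear [phi] carries the product of the shifted data to the original one
    ([phi_mul]). *)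
Definition shift_alpha_fun (x y : g) : m :=
  alpha x y + actl cm (rho x) (b y) + actr cm (b x) (rho y) + b x <o> b y - b (x <o> y).

Lemma shift_alpha_bilinear : bilinear_for *:%R *:%R shift_alpha_fun.
Proof.
by split=> u a x y; rewrite /shift_alpha_fun; lin_expand; zmod.
Qed.

Definition shift_alpha : {linear g -> {linear g -> m}} :=
  curry_lin (mk_bilinear shift_alpha_bilinear).

Let phi (a : g * m) : g * m := (a.1, a.2 + b a.1).

Lemma phi_lift_map a : lift_map cm rho (phi a) = lift_map cm shift_rho a.
Proof. by rewrite /lift_map /= linearD /=; zmod. Qed.

Lemma phi_mul a c :
  phi (lift_mul cm shift_rho shift_alpha a c) = lift_mul cm rho alpha (phi a) (phi c).
Proof.
apply: pair_ext => //=; rewrite /shift_alpha_fun /=.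
rewrite !(linearDl, linearDr) /= cm_peifferl cm_peifferr.
zmod.
Qed.

Lemma shift_lift : is_lift cm shift_rho shift_alpha.
Proof.
move=> x y; have := lift_map_mul liftP (phi (x, 0)) (phi (y, 0)).
rewrite -phi_mul !phi_lift_map /lift_map /=.
rewrite !(linear0, linear0l, linear0r, addr0, add0r) => <-.
by zmod.
Qed.

(** [phi] transports the curvature and fixes [0 * m], where the curvature lies. *)
Lemma shift_lift_d x y z : lift_d cm shift_rho shift_alpha x y z = lift_d cm rho alpha x y z.
Proof.
have e := curv_lift liftP (phi (x, 0)) (phi (y, 0)) (phi (z, 0)).
have phiD p q : phi (p + q) = phi p + phi q.
  by apply: pair_ext; rewrite //= linearD; zmod.
have phiN p : phi (- p) = - phi p.
  by apply: pair_ext; rewrite //= linearN; zmod.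
rewrite /curv -!phi_mul -!(phiN, phiD) in e; rewrite -[RHS](congr1 snd e).
have := curv_lift shift_lift (x, 0) (y, 0) (z, 0); rewrite /curv => ->.
by rewrite /= linear0 addr0.
Qed.

End ChangeOfLift.

(** * Cocycles of crossed module extensions and their invariance *)

Section Classes.
Variables (K : fieldType) (g : preLieAlg K) (V : lmodType K) (r : plRep g V).
Implicit Types (E : cmExt g V) (theta : {linear g -> {linear g -> {linear g -> V}}}).

(** The form of [induces] that mentions no section; the two agree by [inducesP]. *)
Definition induces_lift E := forall y u,
  ce_i E (actl r (ce_pi E y) u) = actl (ce_cm E) y (ce_i E u) /\
  ce_i E (actr r u (ce_pi E y)) = actr (ce_cm E) (ce_i E u) y.

Lemma ce_mu_i E (v : V) : cm_mu (ce_cm E) (ce_i E v) = 0.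
Proof. by apply/ce_exact_m; exists v. Qed.

Lemma ce_pi_mu E u : ce_pi E (cm_mu (ce_cm E) u) = 0.
Proof. by apply/ce_exact_n; exists u. Qed.

Lemma ce_iI E (v w : V) : ce_i E v = ce_i E w -> v = w.
Proof. exact: ce_i_inj. Qed.

Lemma ce_iD E (v w : V) : ce_i E (v + w) = ce_i E v + ce_i E w.
Proof. exact: (linearD (ce_i E)). Qed.

Lemma ce_iN E (v : V) : ce_i E (- v) = - ce_i E v.
Proof. exact: (linearN (ce_i E)). Qed.

Lemma ce_i0 E : ce_i E (0 : V) = 0.
Proof. exact: (linear0 (ce_i E)). Qed.

(** The two Peiffer identities move [cm_mu] from [u] to [ce_i E v], where it vanishes. Hence [n]
    acts on the image of [V] through [g]. *)
Lemma ce_acti E u v : actl (ce_cm E) (cm_mu (ce_cm E) u) (ce_i E v) = 0.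
Proof. by rewrite cm_peifferl -(cm_peifferr (ce_cm E)) ce_mu_i linear0r. Qed.

Lemma ce_iact E u v : actr (ce_cm E) (ce_i E v) (cm_mu (ce_cm E) u) = 0.
Proof. by rewrite cm_peifferr -(cm_peifferl (ce_cm E)) ce_mu_i linear0l. Qed.

Lemma ce_section E : exists rho : {linear g -> ce_n E}, forall x, ce_pi E (rho x) = x.
Proof. exact: section_exists (@ce_pi_surj _ _ _ E). Qed.

Lemma inducesP E : induces r E <-> induces_lift E.
Proof.
split=> [indE y u|indE rho rhoP x u]; last by have := indE (rho x) u; rewrite rhoP.
have [rho rhoP] := ce_section E.
have [w wE] : exists w, cm_mu (ce_cm E) w = y - rho (ce_pi E y).
  by apply/ce_exact_n; rewrite linearB rhoP subrr.
have yE : y = rho (ce_pi E y) + cm_mu (ce_cm E) w by rewrite wE addrC subrK.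
have [el er] := indE rho rhoP (ce_pi E y) u; rewrite el er.
by rewrite {2 4}yE linearDl linearDr /= ce_acti ce_iact !addr0.
Qed.

Definition has_cm_class E theta :=
  exists (rho : {linear g -> ce_n E}) (alpha : {linear g -> {linear g -> ce_m E}}),
  [/\ forall x, ce_pi E (rho x) = x, is_lift (ce_cm E) rho alpha &
      forall x y z, ce_i E (theta x y z) = lift_d (ce_cm E) rho alpha x y z].

Lemma lift_exists E (rho : {linear g -> ce_n E}) : (forall x, ce_pi E (rho x) = x) ->
  exists alpha, is_lift (ce_cm E) rho alpha.
Proof.
move=> rhoP.
have om_bilinear : bilinear_for *:%R *:%R (fun x y => rho x <o> rho y - rho (x <o> y)).
  by split=> u a x y; lin_expand; zmod.
have [x y|alpha alphaP] := @linear_bilift _ _ _ _ _ (cm_mu (ce_cm E))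
    (curry_lin (mk_bilinear om_bilinear)); last by exists alpha.
by apply/ce_exact_n; rewrite /= linearB /= pl_funM !rhoP subrr.
Qed.

Lemma lift_d_trilinear m n (cm : crossedModule m n) (rho : {linear g -> n})
    (alpha : {linear g -> {linear g -> m}}) :
  exists d : {linear g -> {linear g -> {linear g -> m}}},
    forall x y z, d x y z = lift_d cm rho alpha x y z.
Proof.
have d3 x y : linear (lift_d cm rho alpha x y).
  by move=> a z w; rewrite /lift_d; lin_expand; zmod.
have d12 : bilinear_for *:%R *:%R (fun x y => mk_linear (d3 x y)).
  split=> u a x y; apply: linearP_ext => z; rewrite lin_addE lin_scaleE /= /lift_d;
  by lin_expand; zmod.
by exists (curry_lin (mk_bilinear d12)).
Qed.

End Classes.

Section ClassInvariance.
Variables (K : fieldType) (g : preLieAlg K) (V : lmodType K) (r : plRep g V).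
Implicit Types (E : cmExt g V) (theta : {linear g -> {linear g -> {linear g -> V}}}).

Lemma lift_map_pi E (rho : {linear g -> ce_n E}) (a : g * ce_m E) :
  (forall x, ce_pi E (rho x) = x) -> ce_pi E (lift_map (ce_cm E) rho a) = a.1.
Proof. by move=> rhoP; rewrite /lift_map linearD /= rhoP ce_pi_mu addr0. Qed.

Lemma lift_mul_i E (rho : {linear g -> ce_n E}) alpha a (v : V) :
  induces_lift r E -> (forall x, ce_pi E (rho x) = x) ->
  lift_mul (ce_cm E) rho alpha a (0, ce_i E v) = (0, ce_i E (actl r a.1 v)).
Proof.
move=> indE rhoP; rewrite lift_mulM; have [<- _] := indE (lift_map (ce_cm E) rho a) v.
by rewrite lift_map_pi.
Qed.

Lemma lift_i_mul E (rho : {linear g -> ce_n E}) alpha a (v : V) :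
  induces_lift r E -> (forall x, ce_pi E (rho x) = x) ->
  lift_mul (ce_cm E) rho alpha (0, ce_i E v) a = (0, ce_i E (actr r v a.1)).
Proof.
move=> indE rhoP; rewrite lift_Mmul; have [_ <-] := indE (lift_map (ce_cm E) rho a) v.
by rewrite lift_map_pi.
Qed.

Lemma lift_class_exists E (rho : {linear g -> ce_n E}) alpha :
  is_lift (ce_cm E) rho alpha ->
  exists theta, forall x y z, ce_i E (theta x y z) = lift_d (ce_cm E) rho alpha x y z.
Proof.
move=> liftP; have [d dE] := lift_d_trilinear (ce_cm E) rho alpha.
have ic_linear : linear (fun k : {linear g -> V} => ce_i E \o k : {linear g -> ce_m E}).
  by move=> a k k'; apply: linearP_ext => x; rewrite /= linearP.
have [x y|theta thetaE] := @linear_bilift _ _ _ _ _ (mk_linear ic_linear) d.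
  have [z|k kE] := @linear_lift _ _ _ _ (ce_i E) (d x y).
    by apply/ce_exact_m; rewrite dE lift_d_ker.
  by exists k; apply: linearP_ext => z; rewrite -kE.
by exists theta => x y z; rewrite -dE -thetaE.
Qed.

Lemma has_cm_class_exists E : induces_lift r E ->
  exists2 theta, lie_cocycle (homRep r) theta & has_cm_class E theta.
Proof.
move=> indE; have [rho rhoP] := ce_section E.
have [alpha liftP] := lift_exists rhoP.
have [theta thetaE] := lift_class_exists liftP.
exists theta; last by exists rho, alpha.
split=> [x|x y z]; apply: linearP_ext => w; apply: (@ce_iI _ _ _ E).
  by rewrite thetaE /lift_d ce_i0; zmod.
have curvE a b c : curv (lift_mul (ce_cm E) rho alpha) a b c =
    (0, ce_i E (theta a.1 b.1 c.1)).
  by rewrite curv_lift // thetaE.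
(* Each of the three groups on the left of the Bianchi identity is the action of [homRep] on a value
   of [theta], evaluated at [w]. *)
have := curv_bianchi (lift_mul (ce_cm E) rho alpha) (x, 0) (y, 0) (z, 0) (w, 0).
rewrite !curvE !lift_mul_i // !lift_i_mul // => /(congr1 snd) /=.
rewrite ?subr0 ?lin_addE /= ?/hom_act_fun !(ce_iD, ce_iN); exact.
Qed.

(** Two choices differ by a shift of the section, which preserves the cocycle by [shift_lift_d],
    followed by a change of [alpha] by a [lambda] with values in [V], which adds [lie_d1 lambda]. *)
Lemma has_cm_class_coset E theta theta' : induces_lift r E -> has_cm_class E theta ->
  has_cm_class E theta' <->
  exists lambda : {linear g -> {linear g -> V}},
    forall x y, theta' x y = theta x y + lie_d1 (homRep r) lambda x y.
Proof.
move=> indE [rho [alpha [rhoP liftP thetaE]]].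
have add_d1 (rho1 : {linear g -> ce_n E}) (alpha1 alpha2 : {linear g -> {linear g -> ce_m E}})
    (lambda : {linear g -> {linear g -> V}}) :
    (forall x, ce_pi E (rho1 x) = x) ->
    (forall x y, alpha2 x y = alpha1 x y + ce_i E (lambda x y)) ->
    forall x y z, lift_d (ce_cm E) rho1 alpha2 x y z =
      lift_d (ce_cm E) rho1 alpha1 x y z + ce_i E (lie_d1 (homRep r) lambda x y z).
  move=> rho1P alphaE x y z.
  have il a v : ce_i E (actl r a v) = actl (ce_cm E) (rho1 a) (ce_i E v).
    by have [<- _] := indE (rho1 a) v; rewrite rho1P.
  have ir a v : ce_i E (actr r v a) = actr (ce_cm E) (ce_i E v) (rho1 a).
    by have [_ <-] := indE (rho1 a) v; rewrite rho1P.
  rewrite lie_d1E !(lin_addE, lin_oppE) /= /hom_act_fun /pl_br.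
  rewrite !(ce_iD, ce_iN) !il !ir /lift_d !alphaE !(linearDl, linearDr) /=.
  rewrite !(linearB lambda) !(lin_addE, lin_oppE) !(ce_iD, ce_iN).
  by zmod.
split=> [[rho' [alpha' [rho'P lift'P theta'E]]]|[lambda lambdaE]]; last first.
  have alpha2_bilinear : bilinear_for *:%R *:%R (fun x y => alpha x y + ce_i E (lambda x y)).
    by split=> u a x y; lin_expand; zmod.
  exists rho, (curry_lin (mk_bilinear alpha2_bilinear)); split=> // [x y|x y z].
    by rewrite /= linearD /= ce_mu_i addr0 liftP.
  rewrite lambdaE lin_addE ce_iD thetaE.
  by rewrite -(@add_d1 rho alpha (curry_lin (mk_bilinear alpha2_bilinear)) lambda).
have [x|b bE] := @linear_lift _ _ _ _ (cm_mu (ce_cm E)) (rho' \- rho).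
  by apply/ce_exact_n; rewrite /= linearB /= rhoP rho'P subrr.
have rho'E : rho' = shift_rho (ce_cm E) rho b.
  by apply: linearP_ext => x; rewrite /= bE /= addrC subrK.
subst rho'; pose alpha1 := shift_alpha (ce_cm E) rho alpha b.
have lift1 := shift_lift liftP b; rewrite -/alpha1 in lift1.
have [x y|lambda lambdaE] := @linear_bilift _ _ _ _ _ (ce_i E) (alpha' - alpha1).
  apply/ce_exact_m; rewrite !(lin_addE, lin_oppE) linearB /=.
  by rewrite lift'P [X in _ - X]lift1 subrr.
exists lambda => x y; apply: linearP_ext => z; apply: (@ce_iI _ _ _ E).
rewrite theta'E lin_addE ce_iD thetaE -(shift_lift_d liftP b).
apply: add_d1 => // {}x {}y.
by rewrite lambdaE !(lin_addE, lin_oppE) addrC subrK.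
Qed.

Lemma elem_equiv_class E E' theta :
  elem_equiv E E' -> has_cm_class E theta -> has_cm_class E' theta.
Proof.
move=> [p [s [pi smu pis pr pl]]] [rho [alpha [rhoP liftP thetaE]]].
have pc_linear : linear (fun k : {linear g -> ce_m E} => p \o k : {linear g -> ce_m E'}).
  by move=> a k k'; apply: linearP_ext => x; rewrite /= linearP.
exists (s \o rho), (mk_linear pc_linear \o alpha); split=> [x|x y|x y z] /=.
- by rewrite pis rhoP.
- by rewrite -smu liftP linearB /= pl_funM.
- rewrite -pi thetaE /lift_d /= !(linearD p, linearN p) /= ?(linearD p) /= !pr !pl.
  by zmod.
Qed.

(** Forward, each [y] is [s y0] plus an element of the image of [cm_mu], which acts trivially on
    [V]. Backward, the equations are compared in [E'], where [ce_i] is injective. *)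
Lemma elem_equiv_induces E E' : elem_equiv E E' -> induces_lift r E <-> induces_lift r E'.
Proof.
move=> [p [s [pi smu pis pr pl]]]; split=> indE y u.
  have [y0 y0E] := ce_pi_surj E (ce_pi E' y).
  have [w wE] : exists w, cm_mu (ce_cm E') w = y - s y0.
    by apply/ce_exact_n; rewrite linearB /= pis y0E subrr.
  have -> : y = s y0 + cm_mu (ce_cm E') w by rewrite wE addrC subrK.
  rewrite linearD /= pis ce_pi_mu addr0 linearDl linearDr /= ce_acti ce_iact !addr0.
  by have [el er] := indE y0 u; split; rewrite -pi ?el ?er ?pl ?pr pi.
have [el er] := indE (s y) u; rewrite pis in el er.
split.
  have [v vE] : exists v, ce_i E v = actl (ce_cm E) y (ce_i E u).
    by apply/ce_exact_m; rewrite cm_mul ce_mu_i linear0r.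
  rewrite -vE; congr (ce_i E _); apply: (@ce_iI _ _ _ E').
  by rewrite el -(pi v) vE pl pi.
have [v vE] : exists v, ce_i E v = actr (ce_cm E) (ce_i E u) y.
  by apply/ce_exact_m; rewrite cm_mur ce_mu_i linear0l.
rewrite -vE; congr (ce_i E _); apply: (@ce_iI _ _ _ E').
by rewrite er -(pi v) vE pr pi.
Qed.

End ClassInvariance.

(** * The cocycle of the quotient extension *)

Section QuotientClass.
Variables (K : fieldType) (g : preLieAlg K) (V : lmodType K) (r : plRep g V).
Variables (M : lmodType K).
Let P : lmodType K := (g * M)%type.
Variables (mul : {bilinear P -> P -> P}) (j : {linear V -> M}) (t : {linear M -> V}).
Variable theta : {linear g -> {linear g -> {linear g -> V}}}.
Hypothesis tj : forall v, t (j v) = v.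
Hypothesis mul1 : forall a b, (mul a b).1 = a.1 <o> b.1.
Hypothesis mulj : forall a v, mul a (0, j v) = (0, j (actl r a.1 v)).
Hypothesis jmul : forall a v, mul (0, j v) a = (0, j (actr r v a.1)).
Hypothesis mulP : forall a b c, curv mul a b c = (0, j (theta a.1 b.1 c.1)).

Let E := quotient_ext tj mul1 mulj jmul mulP.

Lemma quotient_ext_induces : induces_lift r E.
Proof.
move=> y u; split.
  by rewrite /= /top_actl /lm mulj.
by rewrite /= /top_actr /rm jmul.
Qed.

Let rho_fun (x : g) : ce_n E := top_proj g tj (x, 0).

Lemma quotient_rho_linear : linear rho_fun.
Proof.
move=> a x y; rewrite /rho_fun -linearP; congr (top_proj g tj _).
by congr pair; rewrite /= scaler0 addr0.
Qed.

Let alpha_fun (x y : g) : ce_m E := (mul (x, 0) (y, 0)).2.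

Lemma quotient_alpha_bilinear : bilinear_for *:%R *:%R alpha_fun.
Proof.
have pairD a (x y : g) : (a *: x + y, 0 : M) = a *: (x, 0) + (y, 0).
  by congr pair; rewrite /= scaler0 addr0.
by split=> u a x y; rewrite /alpha_fun pairD ?(linearPl, linearPr).
Qed.

(** With the section given by the classes of [(x, 0)] and the lift read off from
    [mul (x, 0) (y, 0)], [lift_d] is the curvature prescribed by [mulP]. *)
Lemma quotient_ext_class : has_cm_class E theta.
Proof.
exists (mk_linear quotient_rho_linear), (curry_lin (mk_bilinear quotient_alpha_bilinear)).
have rhoE (x : g) : ker_val (top_proj g tj (x, 0)) = (x, 0).
  by rewrite top_projE; apply: pair_ext; rewrite /= ?linear0 ?addr0 ?subr0.
have mulE x y : mul (x, 0) (y, 0) = (x <o> y, 0) + (0, alpha_fun x y).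
  by rewrite [LHS]surjective_pairing mul1; congr pair; rewrite /= ?addr0 ?add0r.
split=> [x|x y|x y z].
- by rewrite /= subr0.
- change (top_proj g tj (0, alpha_fun x y) =
    top_proj g tj (mul (ker_val (rho_fun x)) (ker_val (rho_fun y))) - rho_fun (x <o> y)).
  by rewrite !rhoE -(linearB (top_proj g tj)) mulE [_ + (0, _)]addrC addrK.
have := congr1 snd (mulP (x, 0) (y, 0) (z, 0)); rewrite /curv /= => <-.
rewrite !mulE !(linearDl, linearDr) !(mulE, mulM mul1, Mmul mul1) /=.
have lE a u : actl (ce_cm E) (rho_fun a) u = lm mul (a, 0) u.
  exact: (congr1 (fun b => lm mul b u) (rhoE a)).
have rE a u : actr (ce_cm E) u (rho_fun a) = rm mul u (a, 0).
  exact: (congr1 (fun b => rm mul u b) (rhoE a)).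
rewrite -!lE -!rE /lift_d /=.
by zmod.
Qed.

End QuotientClass.

(* Two extensions with the same cocycle are both dominated by the quotient extension built
   on [ce_m E1 * ce_m E2], with [V] embedded diagonally. *)
Section SameClass.
Variables (K : fieldType) (g : preLieAlg K) (V : lmodType K) (r : plRep g V).
Variables (E1 E2 : cmExt g V) (ind1 : induces_lift r E1) (ind2 : induces_lift r E2).
Variable theta : {linear g -> {linear g -> {linear g -> V}}}.
Variables (rho1 : {linear g -> ce_n E1}) (alpha1 : {linear g -> {linear g -> ce_m E1}}).
Variables (rho2 : {linear g -> ce_n E2}) (alpha2 : {linear g -> {linear g -> ce_m E2}}).
Hypothesis rho1P : forall x, ce_pi E1 (rho1 x) = x.
Hypothesis rho2P : forall x, ce_pi E2 (rho2 x) = x.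
Hypothesis lift1 : is_lift (ce_cm E1) rho1 alpha1.
Hypothesis lift2 : is_lift (ce_cm E2) rho2 alpha2.
Hypothesis theta1 : forall x y z, ce_i E1 (theta x y z) = lift_d (ce_cm E1) rho1 alpha1 x y z.
Hypothesis theta2 : forall x y z, ce_i E2 (theta x y z) = lift_d (ce_cm E2) rho2 alpha2 x y z.

Let M : lmodType K := (ce_m E1 * ce_m E2)%type.
Let P : lmodType K := (g * M)%type.
Let mul1 := lift_mul (ce_cm E1) rho1 alpha1.
Let mul2 := lift_mul (ce_cm E2) rho2 alpha2.
Let p1 (a : P) : g * ce_m E1 := (a.1, a.2.1).
Let p2 (a : P) : g * ce_m E2 := (a.1, a.2.2).

(** The fibre product over [g] of the two lifted algebras; [P] stores the common component in [g]
    once. *)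
Definition fib_mul_fun (a b : P) : P :=
  (a.1 <o> b.1, ((mul1 (p1 a) (p1 b)).2, (mul2 (p2 a) (p2 b)).2)).

Lemma fib_ext a b : p1 a = p1 b -> p2 a = p2 b -> a = b.
Proof.
case: a b => [x [u v]] [y [w z]]; rewrite /p1 /p2 /= => e1 e2.
by case: e1 => -> ->; case: e2 => _ ->.
Qed.

Lemma fib_mul_bilinear : bilinear_for *:%R *:%R fib_mul_fun.
Proof.
split=> u a x y; apply: fib_ext.
- exact: (linearPl mul1 (p1 u) a (p1 x) (p1 y)).
- exact: (linearPl mul2 (p2 u) a (p2 x) (p2 y)).
- exact: (linearPr mul1 (p1 u) a (p1 x) (p1 y)).
- exact: (linearPr mul2 (p2 u) a (p2 x) (p2 y)).
Qed.

Let mul := mk_bilinear fib_mul_bilinear.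

Lemma fib_i_linear : linear (fun v : V => (ce_i E1 v, ce_i E2 v) : M).
Proof.
by move=> a u v; congr pair; [apply: (linearP (ce_i E1))|apply: (linearP (ce_i E2))].
Qed.

Let j := mk_linear fib_i_linear.

Lemma fib_muli a v : mul a (0, j v) = (0, j (actl r a.1 v)).
Proof.
apply: fib_ext; first exact: (lift_mul_i alpha1 (p1 a) v ind1 rho1P).
exact: (lift_mul_i alpha2 (p2 a) v ind2 rho2P).
Qed.

Lemma fib_imul a v : mul (0, j v) a = (0, j (actr r v a.1)).
Proof.
apply: fib_ext; first exact: (lift_i_mul alpha1 (p1 a) v ind1 rho1P).
exact: (lift_i_mul alpha2 (p2 a) v ind2 rho2P).
Qed.

Lemma fib_curv a b c : curv mul a b c = (0, j (theta a.1 b.1 c.1)).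
Proof.
apply: fib_ext.
  transitivity (curv mul1 (p1 a) (p1 b) (p1 c)); first by [].
  by rewrite curv_lift // -theta1.
transitivity (curv mul2 (p2 a) (p2 b) (p2 c)); first by [].
by rewrite curv_lift // -theta2.
Qed.

Lemma fib_fst a b : (mul a b).1 = a.1 <o> b.1. Proof. by []. Qed.

Lemma fib_i_inj : injective j.
Proof. by move=> u v [/ce_iI]. Qed.

Variables (t : {linear M -> V}) (tj : forall v, t (j v) = v).

Let E : cmExt g V := quotient_ext tj fib_fst fib_muli fib_imul fib_curv.

(** The base maps by the first projection, and the top by [lift_map], which is multiplicative and
    kills the image of [V]. *)
Lemma fib_elem1 : elem_equiv E E1.
Proof.
have s_linear : linear (fun x : ce_n E => lift_map (ce_cm E1) rho1 (p1 (ker_val x))).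
  by move=> a x y; rewrite /lift_map /= (linearP rho1) (linearP (cm_mu (ce_cm E1))); zmod.
have proj a : lift_map (ce_cm E1) rho1 (p1 (ker_val (top_proj g tj a))) =
    lift_map (ce_cm E1) rho1 (p1 a).
  by rewrite /lift_map /= subr0 linearB /= ce_mu_i subr0.
have s_hom (x y : ce_n E) :
    mk_linear s_linear (x <o> y) = mk_linear s_linear x <o> mk_linear s_linear y.
  apply: etrans (proj (mul (ker_val x) (ker_val y))) _.
  exact: (lift_map_mul lift1 (p1 (ker_val x)) (p1 (ker_val y))).
have r_hom (x y : ce_m E) :
    (@fst (ce_m E1) (ce_m E2) : {linear ce_m E -> ce_m E1}) (x <o> y) = x.1 <o> y.1.
  transitivity (mul1 (0, x.1) (0, y.1)).2; first by [].
  by rewrite lift_mulM /= /lift_map linear0 add0r cm_peifferl.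
exists (PLHom r_hom), (PLHom s_hom); split=> [//|u|x|x u|x u].
- by rewrite [LHS]/= proj /lift_map linear0 add0r.
- exact: lift_map_pi.
- exact: (congr1 snd (lift_Mmul (ce_cm E1) rho1 alpha1 (p1 (ker_val x)) u.1)).
- exact: (congr1 snd (lift_mulM (ce_cm E1) rho1 alpha1 (p1 (ker_val x)) u.1)).
Qed.

Lemma fib_elem2 : elem_equiv E E2.
Proof.
have s_linear : linear (fun x : ce_n E => lift_map (ce_cm E2) rho2 (p2 (ker_val x))).
  by move=> a x y; rewrite /lift_map /= (linearP rho2) (linearP (cm_mu (ce_cm E2))); zmod.
have proj a : lift_map (ce_cm E2) rho2 (p2 (ker_val (top_proj g tj a))) =
    lift_map (ce_cm E2) rho2 (p2 a).
  by rewrite /lift_map /= subr0 linearB /= ce_mu_i subr0.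
have s_hom (x y : ce_n E) :
    mk_linear s_linear (x <o> y) = mk_linear s_linear x <o> mk_linear s_linear y.
  apply: etrans (proj (mul (ker_val x) (ker_val y))) _.
  exact: (lift_map_mul lift2 (p2 (ker_val x)) (p2 (ker_val y))).
have r_hom (x y : ce_m E) :
    (@snd (ce_m E1) (ce_m E2) : {linear ce_m E -> ce_m E2}) (x <o> y) = x.2 <o> y.2.
  transitivity (mul2 (0, x.2) (0, y.2)).2; first by [].
  by rewrite lift_mulM /= /lift_map linear0 add0r cm_peifferl.
exists (PLHom r_hom), (PLHom s_hom); split=> [//|u|x|x u|x u].
- by rewrite [LHS]/= proj /lift_map linear0 add0r.
- exact: lift_map_pi.
- exact: (congr1 snd (lift_Mmul (ce_cm E2) rho2 alpha2 (p2 (ker_val x)) u.2)).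
- exact: (congr1 snd (lift_mulM (ce_cm E2) rho2 alpha2 (p2 (ker_val x)) u.2)).
Qed.

End SameClass.

Lemma same_class_equiv (K : fieldType) (g : preLieAlg K) (V : lmodType K) (r : plRep g V)
    (E1 E2 : cmExt g V) theta :
  induces_lift r E1 -> induces_lift r E2 ->
  has_cm_class E1 theta -> has_cm_class E2 theta -> cm_equiv E1 E2.
Proof.
move=> ind1 ind2 [rho1 [alpha1 [rho1P lift1 theta1]]] [rho2 [alpha2 [rho2P lift2 theta2]]].
have [t tj] := linear_retraction (@fib_i_inj _ _ _ E1 E2).
have e1 := fib_elem1 ind1 ind2 rho1P rho2P lift1 lift2 theta1 theta2 tj.
have e2 := fib_elem2 ind1 ind2 rho1P rho2P lift1 lift2 theta1 theta2 tj.
by apply: rst_trans (rst_step _ _ _ _ e2); apply/rst_sym/rst_step/e1.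
Qed.

(** * Functionals on the symmetric algebra *)

(** Adjacent transpositions generate all permutations. *)
Lemma perm_invariant (T : eqType) (R : Type) (F : seq T -> R) :
  (forall p x y s, F (p ++ x :: y :: s) = F (p ++ y :: x :: s)) ->
  forall s t, perm_eq s t -> F s = F t.
Proof.
move=> swap.
have front p x s : F (p ++ x :: s) = F (x :: p ++ s).
  elim/last_ind: p s => [ |p y IH] s //.
  by rewrite cat_rcons swap -cat_rcons cat_rcons IH /= cat_rcons.
have gen s : forall p t, perm_eq s t -> F (p ++ s) = F (p ++ t).
  elim: s => [ |x s IH] p t; first by rewrite perm_sym => /perm_nilP->.
  move=> st; have xt : x \in t by rewrite -(perm_mem st) mem_head.
  case/splitPr: xt st => t1 t2; rewrite perm_sym -(cat1s x t2) perm_catCA cat1s perm_cons => st.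
  rewrite -cat_rcons (IH _ (t1 ++ t2)) 1?perm_sym // cat_rcons.
  by rewrite (front p) [in RHS]catA (front (p ++ t1)) -catA.
by move=> s t /(gen _ [::]).
Qed.

Section SymFun.
Variables (K : fieldType) (U W : lmodType K).

(* A linear functional on the symmetric algebra of [U] with values in [W]: the value at
   the monomial [x1 ... xk] is the value at the list [:: x1; ...; xk]. *)
Record symfun := SymFun {
  sf_fun :> seq U -> W;
  sf_lin : forall a x y s,
    sf_fun (a *: x + y :: s) = a *: sf_fun (x :: s) + sf_fun (y :: s);
  sf_perm : forall s t, perm_eq s t -> sf_fun s = sf_fun t }.

Lemma symfun_ext (f h : symfun) : f =1 h -> f = h.
Proof.
case: f h => [f f1 f2] [h h1 h2] /= /funext fh; subst h.
by rewrite (Prop_irrelevance f1 h1) (Prop_irrelevance f2 h2).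
Qed.

HB.instance Definition _ := gen_eqMixin symfun.
HB.instance Definition _ := gen_choiceMixin symfun.

Definition sf_zero : symfun.
by exists (fun=> 0) => // a x y s; rewrite scaler0 addr0.
Defined.

Definition sf_add (f h : symfun) : symfun.
exists (fun s => f s + h s) => [a x y s|s t st]; first by rewrite !sf_lin; zmod.
by rewrite (sf_perm f st) (sf_perm h st).
Defined.

Definition sf_opp (f : symfun) : symfun.
exists (fun s => - f s) => [a x y s|s t st]; first by rewrite !sf_lin; zmod.
by rewrite (sf_perm f st).
Defined.

Definition sf_scale (c : K) (f : symfun) : symfun.
exists (fun s => c *: f s) => [a x y s|s t st]; last by rewrite (sf_perm f st).
by rewrite !sf_lin scalerDr !scalerA mulrC.
Defined.

Lemma sf_addA : associative sf_add.
Proof. by move=> f h k; apply: symfun_ext => s /=; rewrite addrA. Qed.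
Lemma sf_addC : commutative sf_add.
Proof. by move=> f h; apply: symfun_ext => s /=; rewrite addrC. Qed.
Lemma sf_add0 : left_id sf_zero sf_add.
Proof. by move=> f; apply: symfun_ext => s /=; rewrite add0r. Qed.
Lemma sf_addN : left_inverse sf_zero sf_opp sf_add.
Proof. by move=> f; apply: symfun_ext => s /=; rewrite addNr. Qed.

HB.instance Definition _ :=
  GRing.isZmodule.Build symfun sf_addA sf_addC sf_add0 sf_addN.

Lemma sf_scaleA a b f : sf_scale a (sf_scale b f) = sf_scale (a * b) f.
Proof. by apply: symfun_ext => s /=; rewrite scalerA. Qed.
Lemma sf_scale1 : left_id 1 sf_scale.
Proof. by move=> f; apply: symfun_ext => s /=; rewrite scale1r. Qed.
Lemma sf_scaleDr : right_distributive sf_scale +%R.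
Proof. by move=> a f h; apply: symfun_ext => s /=; rewrite scalerDr. Qed.
Lemma sf_scaleDl f : {morph sf_scale^~ f : a b / a + b}.
Proof. by move=> a b; apply: symfun_ext => s /=; rewrite scalerDl. Qed.

HB.instance Definition _ :=
  GRing.Zmodule_isLmodule.Build K symfun sf_scaleA sf_scale1 sf_scaleDr sf_scaleDl.

Lemma sf_addE (f h : symfun) s : (f + h) s = f s + h s. Proof. by []. Qed.
Lemma sf_oppE (f : symfun) s : (- f) s = - f s. Proof. by []. Qed.
Lemma sf_scaleE a (f : symfun) s : (a *: f) s = a *: f s. Proof. by []. Qed.
Lemma sf_swap (f : symfun) x y s : f (x :: y :: s) = f (y :: x :: s).
Proof. by apply: sf_perm; rewrite -cat1s -(cat1s y) perm_catCA. Qed.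

(** Dual to multiplication by [x] in the symmetric algebra. *)
Definition sf_cons_sym (x : U) (f : symfun) : symfun.
exists (fun s => f (x :: s)) => [a y z s|s t st].
  by rewrite !(sf_swap _ x) sf_lin.
by apply: sf_perm; rewrite perm_cons.
Defined.

Lemma sf_cons_bilinear : bilinear_for *:%R *:%R sf_cons_sym.
Proof. by split=> u a x y; apply: symfun_ext => s //=; rewrite sf_lin. Qed.

Definition sf_cons := mk_bilinear sf_cons_bilinear.

Lemma sf_consE x f s : sf_cons x f s = f (x :: s). Proof. by []. Qed.

Lemma sf_consC x y f : sf_cons x (sf_cons y f) = sf_cons y (sf_cons x f).
Proof. by apply: symfun_ext => s; rewrite !sf_consE sf_swap. Qed.

Definition sf_unit (w : W) : symfun.
exists (fun s => if s is [::] then w else 0) => [a x y s|s t].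
  by rewrite scaler0 addr0.
by case: s t => [ |x s] [ |y t] // /perm_size.
Defined.

Lemma sf_unit_linear : linear sf_unit.
Proof.
by move=> a v w; apply: symfun_ext => -[ |x s] //=; rewrite scaler0 addr0.
Qed.

End SymFun.

Arguments sf_cons {K U W}.

(** * The sub-adjacent Lie algebra acting on functionals *)

Section SymRep.
Variables (K : fieldType) (g : preLieAlg K) (W : lmodType K).
Local Notation J := (symfun g W).

(** The value of [f] at [L_x s], with [L_x] the derivation extending left multiplication by [x];
    [sf_cons] sets aside the factor that is not differentiated. *)
Fixpoint lder (x : g) (s : seq g) (f : J) : W :=
  if s is h :: s' then f (x <o> h :: s') + lder x s' (sf_cons h f) else 0.

Lemma lder_nil x f : lder x [::] f = 0. Proof. by []. Qed.

Lemma lder_cons x h s f : lder x (h :: s) f = f (x <o> h :: s) + lder x s (sf_cons h f).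
Proof. by []. Qed.

Lemma lder_linear x s : linear (lder x s).
Proof.
elim: s => [ |h s IH] a f k; first by rewrite !lder_nil scaler0 addr0.
by rewrite !lder_cons linearPr IH sf_addE sf_scaleE; zmod.
Qed.

Lemma lder_linearl s f : linear (fun x => lder x s f).
Proof.
move=> a x y; elim: s f => [ |h s IH] f; first by rewrite !lder_nil scaler0 addr0.
by rewrite !lder_cons linearPl sf_lin IH; zmod.
Qed.

Lemma lder_head x f a y z s :
  lder x (a *: y + z :: s) f = a *: lder x (y :: s) f + lder x (z :: s) f.
Proof.
by rewrite !lder_cons linearPr sf_lin (linearPl sf_cons) lder_linear; zmod.
Qed.

Lemma lder_perm x f s t : perm_eq s t -> lder x s f = lder x t f.
Proof.
apply: (@perm_invariant _ _ (fun s => lder x s f)) => {s t} p y z s.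
elim: p f => [ |h p IH] f; last first.
  rewrite !cat_cons !lder_cons IH; congr (_ + _); apply: sf_perm.
  by rewrite perm_cons perm_cat2l -cat1s -(cat1s z) perm_catCA.
rewrite !cat0s !lder_cons !sf_consE sf_consC (sf_swap f y) (sf_swap f z); zmod.
Qed.

Definition sf_lder_sym (x : g) (f : J) : J := SymFun (lder_head x f) (lder_perm x f).

Lemma sf_lder_bilinear : bilinear_for *:%R *:%R sf_lder_sym.
Proof.
split=> u a x y; apply: symfun_ext => s; first exact: lder_linearl.
exact: lder_linear.
Qed.

Definition sf_lder := mk_bilinear sf_lder_bilinear.

Lemma sf_lderE x f s : sf_lder x f s = lder x s f. Proof. by []. Qed.

Lemma sf_cons_lder x y f :
  sf_cons x (sf_lder y f) = sf_cons (y <o> x) f + sf_lder y (sf_cons x f).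
Proof. by apply: symfun_ext. Qed.

(** Dual to the commutator relation of [L_x] and [L_y], which is the pre-Lie identity on generators;
    dualizing reverses composition, whence the sign. *)
Lemma sf_lder_lder x y f :
  sf_lder x (sf_lder y f) - sf_lder y (sf_lder x f) = - sf_lder (pl_br x y) f.
Proof.
apply: symfun_ext => s; rewrite sf_addE !sf_oppE !sf_lderE.
elim: s f => [ |h s IH] f; first by rewrite !lder_nil subr0 oppr0.
have lderD z k k' : lder z s (k + k') = lder z s k + lder z s k'.
  by have := lder_linear z s 1 k k'; rewrite !scale1r.
have e := pl_mulP x y h.
have e' : pl_br x y <o> h = x <o> (y <o> h) - y <o> (x <o> h).
  by rewrite /pl_br linearBl; apply: (zmod_eq1 e); zmod.
have sfB u v : f (u - v :: s) = f (u :: s) - f (v :: s).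
  by have := sf_lin f (-1) v u s; rewrite !scaleN1r [RHS]addrC [- v + u]addrC.
rewrite !lder_cons !sf_lderE !lder_cons !sf_cons_lder !lderD e' sfB.
by apply: (zmod_eq1 (IH (sf_cons h f))); zmod.
Qed.

Variable r : lieRep (subadjacent g) W.

Definition sf_post_sym (x : g) (f : J) : J.
exists (fun s => r x (f s)) => [a y z s|s t st].
  by rewrite sf_lin linearPr.
by rewrite (sf_perm f st).
Defined.

Lemma sf_post_bilinear : bilinear_for *:%R *:%R sf_post_sym.
Proof.
split=> u a x y; apply: symfun_ext => s /=; first exact: (linearPl r).
exact: (linearPr r).
Qed.

Definition sf_post := mk_bilinear sf_post_bilinear.

Lemma sf_postE x f s : sf_post x f s = r x (f s). Proof. by []. Qed.

Lemma sf_cons_post x y f : sf_cons x (sf_post y f) = sf_post y (sf_cons x f).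
Proof. exact: symfun_ext. Qed.

Lemma sf_lder_post x y f : sf_lder x (sf_post y f) = sf_post y (sf_lder x f).
Proof.
apply: symfun_ext => s; rewrite sf_postE !sf_lderE.
elim: s f => [ |h s IH] f; first by rewrite !lder_nil linear0r.
by rewrite !lder_cons sf_cons_post sf_postE IH linearDr.
Qed.

Lemma sf_post_post x y f :
  sf_post (pl_br x y) f = sf_post x (sf_post y f) - sf_post y (sf_post x f).
Proof. by apply: symfun_ext => s; rewrite sf_addE sf_oppE !sf_postE -(lie_actP r). Qed.

(* Dual to the action [x . s = x s + L_x s] of the sub-adjacent Lie algebra on the
   symmetric algebra, [L_x] being the derivation that extends left multiplication by [x]. *)
Definition sf_act_fun (x : g) (f : J) : J := sf_post x f - sf_cons x f - sf_lder x f.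

Lemma sf_act_bilinear : bilinear_for *:%R *:%R sf_act_fun.
Proof.
split=> u a x y; rewrite /sf_act_fun !(linearPl, linearPr); apply: symfun_ext => s;
by rewrite !(sf_addE, sf_oppE, sf_scaleE); zmod.
Qed.

(** Multiplications commute, derivations represent the bracket, and the commutator of [L_x] with
    multiplication by [y] is multiplication by [x <o> y]; antisymmetrizing gives the bracket. *)
Lemma sf_actP (x y : g) (f : J) : let a := mk_bilinear sf_act_bilinear in
  a (pl_br x y) f = a x (a y f) - a y (a x f).
Proof.
rewrite /= /sf_act_fun !linearBr.
rewrite !sf_cons_post !sf_lder_post !sf_cons_lder (sf_consC y x).
rewrite sf_post_post.
have -> : sf_cons (pl_br x y) f = sf_cons (x <o> y) f - sf_cons (y <o> x) f.
  by rewrite /pl_br linearBl.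
by apply: (zmod_eq1 (esym (sf_lder_lder x y f))); zmod.
Qed.

Definition symRep : lieRep (subadjacent g) J :=
  @LieRep K (subadjacent g) J (mk_bilinear sf_act_bilinear : {bilinear g -> J -> J}) sf_actP.

Lemma symRepE x f s : symRep x f s = r x (f s) - f (x :: s) - lder x s f.
Proof. by []. Qed.

(** [L_x] preserves the degree in the symmetric algebra. *)
Lemma lder_vanish x s (f : J) :
  (forall s', size s' = size s -> f s' = 0) -> lder x s f = 0.
Proof.
elim: s f => [ |h s IH] f // f0; rewrite lder_cons f0 // add0r IH // => s' s's.
by rewrite sf_consE f0 //= s's.
Qed.

Lemma lder_eq x s (f h : J) :
  (forall s', size s' = size s -> f s' = h s') -> lder x s f = lder x s h.
Proof.
elim: s f h => [ |y s IH] f h // fh; rewrite !lder_cons fh //; congr (_ + _).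
by apply: IH => s' s's; rewrite !sf_consE fh //= s's.
Qed.

Lemma sym_d1E (lambda : {linear g -> J}) x y s :
  lie_d1 symRep lambda x y s =
  (r x (lambda y s) - lambda y (x :: s) - lder x s (lambda y)) -
  (r y (lambda x s) - lambda x (y :: s) - lder y s (lambda x)) - lambda (pl_br x y) s.
Proof. by []. Qed.

Lemma symRep_unit x w : symRep x (sf_unit g w) = sf_unit g (r x w).
Proof.
apply: symfun_ext => s; rewrite symRepE.
case: s => [ |h s]; first by rewrite lder_nil !subr0.
by rewrite lder_vanish => [ |[ |? ?] //]; rewrite /= (linear0r r) !subr0.
Qed.

Definition sf_unit_lin : {linear W -> J} := mk_linear (@sf_unit_linear K g W).

End SymRep.

Lemma total_order_exists (T : eqType) :
  exists R : rel T, [/\ total R, transitive R & antisymmetric R].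
Proof.
have [R woR] := well_ordering_principle T.
have chR : wo_chain R predT by move=> A _; apply: woR.
have tot : total R by move=> x y; apply: (wo_chainW chR).
have anti : antisymmetric R by move=> x y; apply: (wo_chain_antisymmetric chR).
exists R; split=> // y x z xy yz.
(* Transitivity is decided by the least of the three elements. *)
have [ |m [[mA lbm] _]] := woR (mem [:: x; y; z]); first by exists x; rewrite mem_head.
move: mA; rewrite !inE => /or3P[]/eqP mE; subst m.
- by apply: lbm; rewrite !inE eqxx !orbT.
- have yx : R y x by apply: lbm; rewrite !inE eqxx.
  by rewrite (anti x y) // xy yx.
- have zy : R z y by apply: lbm; rewrite !inE eqxx !orbT.
  by rewrite (anti z y) // zy yz.
Qed.

(** * Multilinear extension from a basis *)

Section Extension.
Variables (K : fieldType) (U : lmodType K) (B : set U) (basisB : is_basis B).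

Section OneVariable.
Variable W : lmodType K.

Definition ext1 (f : U -> W) : {linear U -> W} := sval (cid (basisB.1 W f)).

Lemma ext1E f x : B x -> ext1 f x = f x.
Proof. by rewrite /ext1; case: cid => /= F FE /FE. Qed.

Lemma ext1_eq (f : U -> W) (F : {linear U -> W}) :
  (forall x, B x -> F x = f x) -> ext1 f =1 F.
Proof. by move=> Ff; apply: basisB.2 => x Bx; rewrite ext1E // Ff. Qed.

Lemma ext1_linear a (f h : U -> W) x :
  ext1 (fun y => a *: f y + h y) x = a *: ext1 f x + ext1 h x.
Proof.
by rewrite (@ext1_eq _ (a \*: ext1 f \+ ext1 h)) // => y By; rewrite /= !ext1E.
Qed.

(** Both sides are linear in [x] and agree on [B]. *)
Lemma ext1C (h : U -> U -> W) x y :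
  ext1 (fun x' => ext1 (h x') y) x = ext1 (fun y' => ext1 (h^~ y') x) y.
Proof.
have F_linear : linear (fun x => ext1 (fun y' => ext1 (h^~ y') x) y).
  move=> a u v; rewrite -ext1_linear; congr (ext1 _ _).
  by apply/funext => y'; rewrite linearP.
apply: (@ext1_eq _ (mk_linear F_linear)) => {}x Bx /=.
by congr (ext1 _ _); apply/funext => y'; rewrite ext1E.
Qed.

End OneVariable.

Variable W : lmodType K.

Fixpoint multi_ext (s : seq U) (f : seq U -> W) : W :=
  if s is x :: s' then ext1 (fun y => multi_ext s' (fun t => f (y :: t))) x else f [::].

Lemma multi_extE s f : (forall x, x \in s -> B x) -> multi_ext s f = f s.
Proof.
elim: s f => [ |x s IH] f Bs //=.
have Bx : B x by apply: Bs; rewrite mem_head.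
by rewrite ext1E // IH // => y ys; apply: Bs; rewrite inE ys orbT.
Qed.

Lemma multi_ext_perm f : (forall s t, perm_eq s t -> f s = f t) ->
  forall s t, perm_eq s t -> multi_ext s f = multi_ext t f.
Proof.
move=> f_perm; apply: (@perm_invariant _ _ (fun s => multi_ext s f)) => p x y s.
elim: p f f_perm => [ |z p IH] f f_perm /=; last first.
  congr (ext1 _ _); apply/funext => z'; apply: IH => s1 s2 s12.
  by apply: f_perm; rewrite perm_cons.
rewrite ext1C; congr (ext1 _ _); apply/funext => x'; congr (ext1 _ _).
apply/funext => y'; congr (multi_ext _ _); apply/funext => t.
by apply: f_perm; rewrite -cat1s -(cat1s x') perm_catCA.
Qed.

(** The extension is made one variable at a time and stays symmetric by [ext1C], without dividing by
    factorials. *)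
Lemma symfun_extension (f : seq U -> W) : (forall s t, perm_eq s t -> f s = f t) ->
  exists phi : symfun U W, forall s, (forall x, x \in s -> B x) -> phi s = f s.
Proof.
move=> f_perm.
have lin a x y s : multi_ext (a *: x + y :: s) f =
    a *: multi_ext (x :: s) f + multi_ext (y :: s) f by rewrite /= linearP.
exists (SymFun lin (multi_ext_perm f_perm)) => s; exact: multi_extE.
Qed.

(** The factors are reduced to basis vectors one at a time; [p] collects those already reduced. *)
Lemma symfun_basis_eq (phi psi : symfun U W) k :
  (forall s, (forall x, x \in s -> B x) -> size s = k -> phi s = psi s) ->
  forall s, size s = k -> phi s = psi s.
Proof.
move=> eqB s sk.
suff gen p : (forall x, x \in p -> B x) -> size (s ++ p) = k -> phi (s ++ p) = psi (s ++ p).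
  by have := gen [::]; rewrite cats0; apply.
elim: s p {sk} => [ |x s IH] p Bp //= sk; first exact: eqB.
have lin (chi : symfun U W) : linear (fun x => chi (x :: s ++ p)).
  by move=> a y z; rewrite sf_lin.
apply: (basisB.2 _ (mk_linear (lin phi)) (mk_linear (lin psi))) => y By /=.
have yE (chi : symfun U W) : chi (y :: s ++ p) = chi (s ++ y :: p).
  by apply: sf_perm; rewrite -cat1s -(cat1s y p) perm_catCA.
rewrite !yE IH //; last by rewrite -sk /= !size_cat /= addnS.
by move=> z; rewrite inE => /predU1P[->|/Bp].
Qed.

End Extension.

(** * An explicit primitive in the Koszul complex *)

Section Koszul.
Variables (K : fieldType) (U W : lmodType K).
Variables (kappa : {linear U -> {linear U -> symfun U W}}) (n : nat).
Hypothesis kappa_alt : forall x, kappa x x = 0.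
Hypothesis kappa_closed : forall x y z s, (size s).+1 = n ->
  kappa y z (x :: s) + kappa z x (y :: s) + kappa x y (z :: s) = 0.

Variable R : rel U.
Hypotheses (totR : total R) (trR : transitive R) (antiR : antisymmetric R).

(* [delta i] vanishes on the monomials all of whose factors are above [i]; the equation
   [delta i (j t) - delta j (i t) = kappa i j t] then forces its other values. *)
Definition koszul_fun (i : U) (t : seq U) : W :=
  if size t == n.+1 then
    if sort R t is m :: t' then if R i m then 0 else kappa i m t' else 0
  else 0.

Lemma koszul_perm i s t : perm_eq s t -> koszul_fun i s = koszul_fun i t.
Proof.
move=> st; rewrite /koszul_fun (perm_size st).
by rewrite ((perm_sortP totR trR antiR s t) st).
Qed.

Lemma koszul_min i m t : (forall z, z \in t -> R m z) -> size t = n ->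
  koszul_fun i (m :: t) = if R i m then 0 else kappa i m t.
Proof.
move=> mt tn; rewrite /koszul_fun /= tn eqxx.
have -> : sort R (m :: t) = m :: sort R t.
  apply: (sorted_eq trR antiR); rewrite ?sort_sorted //=.
    rewrite path_min_sorted ?sort_sorted //; apply/allP => z.
    by rewrite mem_sort; apply: mt.
  by rewrite perm_sort perm_cons perm_sym perm_sort.
by rewrite (sf_perm _ (permEl (perm_sort R t))).
Qed.

Lemma reflR x : R x x. Proof. by have := totR x x; rewrite orbb. Qed.

Lemma min_exists t : t != [::] -> exists m t', perm_eq t (m :: t') /\
  forall z, z \in t' -> R m z.
Proof.
case E : (sort R t) => [ |m t'] t0.
  by have := perm_sort R t t; rewrite perm_refl E perm_sym => /perm_nilP t_nil; rewrite t_nil in t0.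
exists m, t'; split; first by rewrite -E perm_sym perm_sort.
by have := sort_sorted totR t; rewrite E /= => /(order_path_min trR)/allP.
Qed.

Lemma kappaC x y : kappa x y = - kappa y x.
Proof. exact: (alternatingC _ _ kappa_alt). Qed.

(** By antisymmetry, [R i j] may be assumed. If [i] is below all factors of [t], the first term
    vanishes and the second is given by definition. *)
Lemma koszul_eq i j t : size t = n ->
  koszul_fun i (j :: t) - koszul_fun j (i :: t) = kappa i j t.
Proof.
wlog ij : i j / R i j => [gen| ] tn.
  have [/gen->//|/gen/(_ tn) e] := orP (totR i j).
  by rewrite kappaC sf_oppE -e opprB.
have [it| ] := pselect (forall z, z \in t -> R i z).
  rewrite (koszul_min _ it tn).
  have -> : koszul_fun i (j :: t) = 0.
    have [//|m [t' [pm mt']]] := @min_exists (j :: t).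
    have t'n : size t' = n by have := perm_size pm; rewrite /= tn => -[->].
    rewrite (koszul_perm _ pm) koszul_min //.
    have : m \in j :: t by rewrite (perm_mem pm) mem_head.
    by rewrite inE => /predU1P[->|/it->]; rewrite ?ij.
  case: ifP => [ji|_]; last by rewrite sub0r kappaC sf_oppE opprK.
  by rewrite (antiR (introT andP (conj ij ji))) kappa_alt subr0.
(* Otherwise the least factor [m] of [t] is strictly below [i] and [j]. Both terms are then read off
   at [m], and closedness for [i], [j], [m] concludes. *)
move=> /existsNP[z /not_implyP[zt /negP iz]].
have [ |m [t' [pm mt']]] := @min_exists t; first by case: (t) zt.
have t'n : (size t').+1 = n by rewrite -tn (perm_size pm).
have mz : R m z.
  by move: zt; rewrite (perm_mem pm) inE => /predU1P[->|/mt'//]; apply: reflR.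
have im : ~~ R i m by apply: contra iz => im; apply: trR mz.
have mi : R m i by have := totR i m; rewrite (negbTE im).
have mj : R m j := trR mi ij.
have jm : ~~ R j m.
  by apply: contra im => jm; rewrite (antiR (introT andP (conj jm mj))) in ij.
have swap k : perm_eq (k :: t) (m :: k :: t').
  by rewrite -(cat1s m) -(cat1s k t') perm_sym perm_catCA cat1s perm_cons perm_sym.
have minE k l : R m k -> ~~ R l m -> koszul_fun l (k :: t) = kappa l m (k :: t').
  move=> mk lm; rewrite (koszul_perm _ (swap k)) koszul_min ?(negbTE lm) //=.
  by move=> y; rewrite inE => /predU1P[->|/mt'].
rewrite !minE // (sf_perm _ pm).
have := kappa_closed i j m t'n; rewrite (kappaC m i) sf_oppE => e.
by apply: (zmod_eq1 (esym e)); zmod.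
Qed.

End Koszul.

(** [koszul_fun] is used on basis vectors and basis monomials only, and extended linearly; both
    claims are linear in every argument, so a basis suffices to check them. *)
Lemma koszul_exact (K : fieldType) (U W : lmodType K)
    (kappa : {linear U -> {linear U -> symfun U W}}) n :
  (forall x, kappa x x = 0) ->
  (forall x y z s, (size s).+1 = n ->
     kappa y z (x :: s) + kappa z x (y :: s) + kappa x y (z :: s) = 0) ->
  exists delta : {linear U -> symfun U W},
    (forall x s, size s <> n.+1 -> delta x s = 0) /\
    (forall x y s, size s = n -> delta x (y :: s) - delta y (x :: s) = kappa x y s).
Proof.
move=> alt closed; have [R [totR trR antiR]] := total_order_exists U.
have [B basisB] := basis_exists U.
have dex i : exists phi : symfun U W, forall s, (forall x, x \in s -> B x) ->
    phi s = koszul_fun kappa n R i s.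
  by apply: symfun_extension => // s t; apply: koszul_perm.
have [delta deltaE] := basisB.1 _ (fun i => sval (cid (dex i))).
have {}deltaE i s : B i -> (forall x, x \in s -> B x) ->
    delta i s = koszul_fun kappa n R i s.
  by move=> Bi Bs; rewrite deltaE //; case: cid => /= phi ->.
have ev_linear s : linear (fun x => delta x s).
  by move=> a x y; rewrite linearP sf_addE sf_scaleE.
exists delta; split=> [x s sn|x y s sn].
  apply: (basisB.2 _ (mk_linear (ev_linear s)) \0) => {}x Bx.
  apply: (@symfun_basis_eq _ _ _ basisB _ (delta x) 0 (size s)) => // t Bt ts.
  by rewrite deltaE // /koszul_fun ts; case: eqP => // /sn.
have D_linear y' s' : linear (fun x => delta x (y' :: s') - delta y' (x :: s') - kappa x y' s').
  move=> a u v; rewrite sf_lin !(linearP delta, linearP kappa).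
  by rewrite !(lin_addE, lin_scaleE, sf_addE, sf_scaleE); zmod.
(* Antisymmetry turns linearity in the first variable into linearity in the second. *)
have DC x' y' s' : delta x' (y' :: s') - delta y' (x' :: s') - kappa x' y' s' =
    - (delta y' (x' :: s') - delta x' (y' :: s') - kappa y' x' s').
  by rewrite (alternatingC _ _ alt) sf_oppE; zmod.
apply/eqP; rewrite -subr_eq0; apply/eqP.
apply: (basisB.2 _ (mk_linear (D_linear y s)) \0) => {}x Bx.
rewrite mk_linearE DC; apply/eqP; rewrite oppr_eq0; apply/eqP.
apply: (basisB.2 _ (mk_linear (D_linear x s)) \0) => {}y By.
rewrite mk_linearE; apply/eqP; rewrite subr_eq0; apply/eqP.
apply: (@symfun_basis_eq _ _ _ basisB _
  (sf_cons x (delta y) - sf_cons y (delta x)) (kappa y x) n) sn => t Bt tn.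
rewrite sf_addE sf_oppE !sf_consE.
have Bcons z : B z -> forall w, w \in z :: t -> B w.
  by move=> Bz w; rewrite inE => /predU1P[->|/Bt].
by rewrite !deltaE //; [apply: koszul_eq|apply: Bcons|apply: Bcons].
Qed.

(** * A primitive of the cocycle, degree by degree *)

Section Primitive.
Variables (K : fieldType) (g : preLieAlg K) (W : lmodType K).
Variables (r : lieRep (subadjacent g) W).
Variables (theta : {linear g -> {linear g -> W}}) (thetaP : lie_cocycle r theta).
Local Notation J := (symfun g W).

Lemma unit_cocycle_bilinear :
  bilinear_for *:%R *:%R (fun x y : g => sf_unit_lin g W (theta x y)).
Proof. by split=> u a x y; lin_expand. Qed.

Definition unit_cocycle : {linear g -> {linear g -> J}} :=
  curry_lin (mk_bilinear unit_cocycle_bilinear).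

Lemma unit_cocycleE x y : unit_cocycle x y = sf_unit_lin g W (theta x y).
Proof. by []. Qed.

Lemma unit_cocycleP : lie_cocycle (symRep r) unit_cocycle.
Proof.
split=> [x|x y z]; rewrite !unit_cocycleE ?thetaP.1 ?linear0 //.
have := congr1 (sf_unit_lin g W) (thetaP.2 x y z).
by rewrite !(linearD (sf_unit_lin g W)) !symRep_unit.
Qed.

Definition defect (lambda : {linear g -> J}) : {linear g -> {linear g -> J}} :=
  unit_cocycle - lie_d1 (symRep r) lambda.

Lemma defectE lambda x y s :
  defect lambda x y s = sf_unit g (theta x y) s - lie_d1 (symRep r) lambda x y s.
Proof. by []. Qed.

Definition primitive_upto n (lambda : {linear g -> J}) :=
  forall x y s, (size s < n)%N -> defect lambda x y s = 0.

(** The defect is a cocycle vanishing below degree [n]. In its cocycle identity in degree [n - 1]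
    only the multiplication terms, which raise the degree, survive; so its part of degree [n] is
    Koszul closed. The correction [delta] lives in degree [n + 1]. *)
Lemma primitive_step n lambda : primitive_upto n lambda ->
  exists lambda' : {linear g -> J}, primitive_upto n.+1 lambda' /\
    forall x s, (size s <= n)%N -> lambda' x s = lambda x s.
Proof.
move=> prim.
have [alt closed] : lie_cocycle (symRep r) (defect lambda).
  exact: lie_cocycleB unit_cocycleP (lie_d1_cocycle (symRep r) lambda).
have [x y z s sn|delta [delta0 deltaE]] := @koszul_exact _ _ _ (defect lambda) n alt.
  have small u v s' : size s' = size s -> defect lambda u v s' = 0.
    by move=> s's; apply: prim; rewrite s's -sn.
  have : r x (defect lambda y z s) - defect lambda y z (x :: s) - lder x s (defect lambda y z) +
      (r y (defect lambda z x s) - defect lambda z x (y :: s) - lder y s (defect lambda z x)) +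
      (r z (defect lambda x y s) - defect lambda x y (z :: s) - lder z s (defect lambda x y)) =
      defect lambda (pl_br x y) z s + defect lambda (pl_br y z) x s +
      defect lambda (pl_br z x) y s.
    exact: (congr1 (fun f : J => f s) (closed x y z)).
  move: (defect lambda) small => D small.
  rewrite !lder_vanish; try by move=> s' s's; apply: small.
  rewrite !(small _ _ _ (erefl (size s))) !(linear0r r) => e.
  by apply: (zmod_eq1 (esym e)); zmod.
exists (lambda + delta); split=> [x y s sn|x s sn]; last first.
  rewrite lin_addE sf_addE delta0 ?addr0 // => e.
  by rewrite e ltnn in sn.
have size_neq u s' : (size s' <= n)%N -> delta u s' = 0.
  by move=> s'n; apply: delta0 => e; rewrite e ltnn in s'n.
have lder0 u v : lder u s (delta v) = 0.
  by apply: lder_vanish => s' s's; apply: size_neq; rewrite s's.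
have d1E : lie_d1 (symRep r) delta x y s = delta x (y :: s) - delta y (x :: s).
  by rewrite sym_d1E !lder0 !(size_neq _ s) // !(linear0r r); zmod.
rewrite defectE lie_d1D sf_addE d1E.
move: sn; rewrite ltnS leq_eqVlt => /predU1P[sn|sn].
  by rewrite deltaE // defectE; zmod.
rewrite !(size_neq _ (_ :: s)) // -[RHS](prim x y s sn) defectE; zmod.
Qed.

(** Values in degree [k] no longer change after stage [k], so the successive corrections converge
    degreewise. *)
Lemma primitive_exists : exists lambda : {linear g -> J},
  forall x y, lie_d1 (symRep r) lambda x y = sf_unit g (theta x y).
Proof.
have prim0 : primitive_upto 0 0 by [].
pose step n (l : {l | primitive_upto n l}) := cid (primitive_step (svalP l)).
pose seq_prim := nat_rect (fun n => {l | primitive_upto n l}) (exist _ 0 prim0)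
  (fun n l => exist _ (sval (step n l)) (svalP (step n l)).1).
pose lam n := sval (seq_prim n).
have lamS n x s : (size s <= n)%N -> lam n.+1 x s = lam n x s.
  exact: (svalP (step n (seq_prim n))).2.
have lamE x s n : (size s <= n)%N -> lam n x s = lam (size s) x s.
  elim: n => [ |n IH]; first by rewrite leqn0 => /eqP->.
  by rewrite leq_eqVlt => /predU1P[->//|sn]; rewrite lamS // IH.
have lim_lin x a y z s : lam (size s).+1 x (a *: y + z :: s) =
    a *: lam (size s).+1 x (y :: s) + lam (size s).+1 x (z :: s) by rewrite sf_lin.
have lim_perm x s t : perm_eq s t -> lam (size s) x s = lam (size t) x t.
  by move=> st; rewrite (perm_size st) (sf_perm _ st).
pose lim x : J := @SymFun K g W (fun s => lam (size s) x s) (lim_lin x) (lim_perm x).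
have lim_linear : linear lim.
  by move=> a x y; apply: symfun_ext => s; rewrite /= linearP.
exists (mk_linear lim_linear) => x y; apply: symfun_ext => s.
(* The equation at [s] involves the degrees [size s] and [size s + 1]. At stage [(size s).+1] both
   are final, and the defect already vanishes at [s]. *)
have limE u s' : (size s' <= (size s).+1)%N -> lam (size s).+1 u s' = mk_linear lim_linear u s'.
  exact: lamE.
have lderE u v : lder u s (lam (size s).+1 v) = lder u s (mk_linear lim_linear v).
  by apply: lder_eq => s' s's; rewrite limE // s's.
have := svalP (seq_prim (size s).+1) x y s (ltnSn _).
rewrite -/(lam _) defectE !sym_d1E !lderE !limE // => e.
by apply: (zmod_eq1 (esym e)); zmod.
Qed.

End Primitive.

(** * Realization of cocycles and the correspondence *)

Lemma lder_post (K : fieldType) (g : preLieAlg K) (W V : lmodType K)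
    (ev : {linear W -> V}) (f : symfun g W) (h : symfun g V) x s :
  (forall s, ev (f s) = h s) -> ev (lder x s f) = lder x s h.
Proof.
elim: s f h => [ |y s IH] f h fh; first by rewrite !lder_nil linear0.
by rewrite !lder_cons linearD fh (IH _ (sf_cons y h)) // => t; rewrite !sf_consE.
Qed.

Section Realization.
Variables (K : fieldType) (g : preLieAlg K) (V : lmodType K) (r : plRep g V).
Local Notation I := (symfun g V).

Definition left_rep : lieRep (subadjacent g) V :=
  @LieRep K (subadjacent g) V (actl r) (actlP r).

(* The right action making [Hom(S(g), V)] a [g]-module. *)
Definition coind_actr_fun (f : I) (y : g) : I.
exists (fun s => actr r (f s) y) => [a z w s|s t st].
  by rewrite sf_lin linearPl.
by rewrite (sf_perm f st).
Defined.

Lemma coind_actr_bilinear : bilinear_for *:%R *:%R coind_actr_fun.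
Proof.
split=> u a x y; apply: symfun_ext => s /=.
  exact: (linearPl (actr r)).
exact: (linearPr (actr r)).
Qed.

Definition coind_actr := mk_bilinear coind_actr_bilinear.

Lemma coind_actrE f y s : coind_actr f y s = actr r (f s) y. Proof. by []. Qed.

Definition coind_actl : {bilinear g -> I -> I} := mk_bilinear (sf_act_bilinear left_rep).

Lemma coind_actlE x f s : coind_actl x f s = actl r x (f s) - f (x :: s) - lder x s f.
Proof. by []. Qed.

(** The right action affects values only and commutes with the multiplication and derivation parts
    of the left action; what remains is [actrP] applied to [f s]. *)
Lemma coind_actrP (x y : g) (f : I) :
  coind_actr (coind_actl x f) y - coind_actl x (coind_actr f y) =
  coind_actr (coind_actr f x) y - coind_actr f (x <o> y).
Proof.
apply: symfun_ext => s; rewrite !(sf_addE, sf_oppE) !(coind_actrE, coind_actlE).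
rewrite !linearBl /=.
have ev_linear : linear (fun v => actr r v y) by move=> a u v; rewrite linearPl.
have e := lder_post (ev := mk_linear ev_linear) x s (fun s => erefl (coind_actr f y s)).
rewrite -e /=.
by apply: (zmod_eq1 (actrP r x y (f s))); zmod.
Qed.

Definition coind : plRep g I := PLRep (sf_actP left_rep) coind_actrP.

Lemma coind_actionl (x : g) (u v : trivialPL I) :
  (actl coind x u : trivialPL I) <o> v - actl coind x (u <o> v) =
  (actr coind u x : trivialPL I) <o> v - u <o> actl coind x v.
Proof.
have -> : actl coind x (u <o> v) = 0 by exact: linear0r.
by [].
Qed.

Lemma coind_actionr (x : g) (u v : trivialPL I) :
  actr coind (u <o> v) x - u <o> actr coind v x =
  actr coind (v <o> u) x - v <o> actr coind u x.
Proof. by []. Qed.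

Definition coind_action : plAction g (trivialPL I) :=
  @PLAction K g (trivialPL I) coind coind_actionl coind_actionr.

Lemma zero_mu_hom (u v : trivialPL I) : (\0 : {linear trivialPL I -> g}) (u <o> v) = 0 <o> 0.
Proof. by rewrite /= linear0l. Qed.

Lemma coind_mur (x : g) (u : trivialPL I) :
  PLHom zero_mu_hom (actr coind_action u x) = PLHom zero_mu_hom u <o> x.
Proof. by rewrite /= linear0l. Qed.

Lemma coind_mul (x : g) (u : trivialPL I) :
  PLHom zero_mu_hom (actl coind_action x u) = x <o> PLHom zero_mu_hom u.
Proof. by rewrite /= linear0r. Qed.

Lemma coind_peifferl (u v : trivialPL I) :
  actl coind_action (PLHom zero_mu_hom u) v = u <o> v.
Proof. exact: (linear0l coind_actl). Qed.

Lemma coind_peifferr (u v : trivialPL I) :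
  actr coind_action u (PLHom zero_mu_hom v) = u <o> v.
Proof. exact: (linear0r coind_actr). Qed.

(** With zero structure map, every [alpha] is a lift for the section [idfun]. *)
Definition coind_cm : crossedModule (trivialPL I) g :=
  CrossedModule coind_mur coind_mul coind_peifferl coind_peifferr.

Variable theta : {linear g -> {linear g -> {linear g -> V}}}.
Hypothesis thetaP : lie_cocycle (homRep r) theta.

(** A map from [g] to functionals with values in [Hom(g, V)] is a bilinear map to functionals with
    values in [V]. Under this exchange of arguments [lie_d1] becomes [lift_d]. *)
Lemma coind_primitive : exists alpha : {linear g -> {linear g -> I}},
  is_lift coind_cm idfun alpha /\
  forall x y z, lift_d coind_cm idfun alpha x y z = sf_unit g (theta x y z).
Proof.
have [lambda lambdaE] := primitive_exists thetaP.
have a_lin x y a u v s :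
    lambda x (a *: u + v :: s) y = a *: lambda x (u :: s) y + lambda x (v :: s) y.
  by rewrite sf_lin.
have a_perm x y s t : perm_eq s t -> lambda x s y = lambda x t y.
  by move=> st; rewrite (sf_perm _ st).
pose alpha0 x y : I := @SymFun K g V (fun s => lambda x s y) (a_lin x y) (a_perm x y).
have alpha0E x y s : alpha0 x y s = lambda x s y by [].
have alpha0_bilinear : bilinear_for *:%R *:%R alpha0.
  split=> u a x y; apply: symfun_ext => s.
    by rewrite sf_addE sf_scaleE !alpha0E (linearP lambda).
  by rewrite sf_addE sf_scaleE !alpha0E linearP.
pose alpha : {linear g -> {linear g -> I}} := curry_lin (mk_bilinear alpha0_bilinear).
have alphaE x y s : alpha x y s = lambda x s y by [].
exists alpha; split=> [x y|x y z]; first by rewrite /= subrr.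
apply: symfun_ext => s.
have lderE a b c : lder a s (lambda b) c = lder a s (alpha b c).
  have ev_linear : linear (fun f : {linear g -> V} => f c) by [].
  exact: (lder_post (ev := mk_linear ev_linear)).
have e : (actl r x (lambda y s z) + actr r (lambda y s x) z - lambda y s (x <o> z)
      - lambda y (x :: s) z - lder x s (lambda y) z)
    - (actl r y (lambda x s z) + actr r (lambda x s y) z - lambda x s (y <o> z)
      - lambda x (y :: s) z - lder y s (lambda x) z)
    - (lambda (x <o> y) s z - lambda (y <o> x) s z) = sf_unit g (theta x y) s z.
  rewrite -(lambdaE x y); congr (_ - _); symmetry.
  by rewrite -[LHS]/(lambda (x <o> y - y <o> x) s z) linearB.
have -> : sf_unit g (theta x y z) s = sf_unit g (theta x y) s z by case: (s).
transitivity ((actl r x (alpha y z s) - alpha y z (x :: s) - lder x s (alpha y z)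
      + alpha x (y <o> z) s) - (actr r (alpha x y s) z + alpha (x <o> y) z s)
    - (actl r y (alpha x z s) - alpha x z (y :: s) - lder y s (alpha x z)
      + alpha y (x <o> z) s) + (actr r (alpha y x s) z + alpha (y <o> x) z s)); first by [].
by rewrite -!lderE !alphaE; apply: (zmod_eq1 e); zmod.
Qed.

Lemma coind_lift_map (a : g * I) : lift_map coind_cm idfun a = a.1.
Proof. by rewrite /lift_map /= addr0. Qed.

Lemma class_realized : exists2 E : cmExt g V, induces_lift r E & has_cm_class E theta.
Proof.
have [alpha [liftP alphaE]] := coind_primitive.
pose mul := lift_mul coind_cm idfun alpha.
pose j : {linear V -> I} := sf_unit_lin g V.
have t_linear : linear (fun f : I => f [::]) by [].
have tj v : mk_linear t_linear (j v) = v by [].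
have mulj (a : g * I) v : mul a (0, j v) = (0, j (actl r a.1 v)).
  rewrite [LHS]lift_mulM coind_lift_map; congr pair.
  exact: (symRep_unit left_rep).
have jmul (a : g * I) v : mul (0, j v) a = (0, j (actr r v a.1)).
  rewrite [LHS]lift_Mmul coind_lift_map; congr pair.
  by apply: symfun_ext => -[ |x s] //=; rewrite linear0l.
have mulP (a b c : g * I) : curv mul a b c = (0, j (theta a.1 b.1 c.1)).
  by rewrite [LHS]curv_lift // alphaE.
have mul1 (a b : g * I) : (mul a b).1 = a.1 <o> b.1 by [].
exists (quotient_ext tj mul1 mulj jmul mulP).
  exact: quotient_ext_induces.
exact: quotient_ext_class.
Qed.

End Realization.

(** * The bijection between the two sets of classes *)

Section Correspondence.
Variables (K : fieldType) (g : preLieAlg K) (V : lmodType K) (r : plRep g V).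
Local Notation A := (subadjacent g).
Local Notation W := {linear g -> V}.

(** An elementary equivalence carries cocycles forward. The reverse inclusion follows because both
    sets of cocycles are cosets of the same coboundaries. *)
Lemma cm_equiv_invariant (E E' : cmExt g V) : cm_equiv E E' ->
  (induces_lift r E <-> induces_lift r E') /\
  (induces_lift r E -> forall theta, has_cm_class E theta <-> has_cm_class E' theta).
Proof.
elim=> {E E'} [E E' EE'|E|E E' _ [ind cl]|E E' E2 _ [ind1 cl1] _ [ind2 cl2]].
- split=> [ |indE theta]; first exact: elem_equiv_induces EE'.
  have indE' := (elem_equiv_induces r EE').1 indE.
  split=> [ |cl']; first exact: elem_equiv_class.
  have [theta1 _ cl1] := has_cm_class_exists indE.
  apply/(has_cm_class_coset _ indE cl1)/(has_cm_class_coset _ indE') => //.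
  exact: elem_equiv_class EE' cl1.
- by split.
- by split=> [ |/ind indE theta]; [rewrite ind|rewrite cl].
- split=> [ |indE theta]; first by rewrite ind1.
  by rewrite cl1 // cl2 //; apply/ind1.
Qed.

Lemma ab_equiv_eqP (E1 E2 : abExt (homRep r)) theta2 : has_lie_class E2 theta2 ->
  ab_equiv E1 = ab_equiv E2 <-> has_lie_class E1 theta2.
Proof.
move=> cl2; split=> [e12|cl1].
  have : ab_equiv E2 E2 by apply/(ab_equiv_class _ cl2).
  by rewrite -e12 => /(ab_equiv_class _ cl2).
apply/funext => X; apply/propext; have [thetaX _ clX] := has_lie_class_exists X.
rewrite !(ab_equiv_class _ clX).
by rewrite (has_lie_class_coset _ cl1) (has_lie_class_coset _ cl2).
Qed.

Lemma cm_equiv_eqP (E1 E2 : cmExt g V) : cm_equiv E1 = cm_equiv E2 <-> cm_equiv E1 E2.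
Proof.
split=> [->|e12]; first exact: rst_refl.
apply/funext => X; apply/propext; split=> e; last exact: rst_trans e12 e.
exact: rst_trans (rst_sym _ _ _ _ e12) e.
Qed.

Lemma cext_class (C : CExt r) : exists theta, lie_cocycle (homRep r) theta /\
  exists E, [/\ induces_lift r E, sval C = cm_equiv E & has_cm_class E theta].
Proof.
case: C => C [E /inducesP indE CE] /=.
have [theta thetaP cl] := has_cm_class_exists indE.
by exists theta; split=> //; exists E.
Qed.

End Correspondence.

Theorem corollary3p7 (K : fieldType) (g : preLieAlg K) (V : lmodType K)
    (r : plRep g V) :
  exists f : CExt r -> AExt (homRep r), bijective f.
Proof.
pose theta (C : CExt r) := sval (cid (cext_class C)).
have thetaP C : lie_cocycle (homRep r) (theta C) by rewrite /theta; case: cid => ? [].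
have thetaE C : exists E, [/\ induces_lift r E, sval C = cm_equiv E & has_cm_class E (theta C)].
  by rewrite /theta; case: cid => ? [].
pose f (C : CExt r) : AExt (homRep r) :=
  exist _ (ab_equiv (cocycle_ext (thetaP C))) (ex_intro _ _ erefl).
exists f.
(* Equal images mean that the chosen cocycles differ by a coboundary; then [E] also has the cocycle
   of [C'], and [same_class_equiv] applies. *)
have f_inj : injective f.
  move=> C C' /(congr1 sval) /= /(ab_equiv_eqP _ (cocycle_ext_class (thetaP C'))).
  move=> /(has_lie_class_coset _ (cocycle_ext_class (thetaP C))) e.
  have [E [indE CE cl]] := thetaE C; have [E' [indE' CE' cl']] := thetaE C'.
  have EE' : cm_equiv E E'.
    apply: (same_class_equiv indE indE' _ cl').
    exact/(has_cm_class_coset _ indE cl).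
  case: C C' CE CE' {cl cl' e} => [C0 C0P] [C0' C0P'] /= CE CE'; apply: eq_exist.
  by rewrite CE CE'; apply/cm_equiv_eqP.
(* [class_realized] gives [E0] with the cocycle [theta0] of [Eh]. The cocycle chosen for the class
   of [E0] is another cocycle of [E0], so it differs from [theta0] by a coboundary. *)
have f_surj (D : AExt (homRep r)) : exists C, f C = D.
  case: D => D [Eh DE]; have [theta0 theta0P cl0] := has_lie_class_exists Eh.
  have [E0 ind0 clE0] := class_realized theta0P.
  pose C : CExt r := exist _ (cm_equiv E0) (ex_intro2 _ _ E0 ((inducesP r E0).2 ind0) erefl).
  exists C; apply: eq_exist; rewrite DE.
  have [E [indE /= /esym/cm_equiv_eqP EE0 cl]] := thetaE C.
  have cl' := ((cm_equiv_invariant r EE0).2 indE _).1 cl.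
  apply/esym/(ab_equiv_eqP _ (cocycle_ext_class (thetaP C))).
  apply/(has_lie_class_coset _ cl0).
  exact/(has_cm_class_coset _ ind0 clE0).
exists (fun D => sval (cid (f_surj D))) => [C|D]; last by case: cid.
by apply: f_inj; case: cid.
Qed.
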